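(* Let $G=G_1\ast_A G_2$ be an amalgam of finite groups. Given $h_1,\ldots,h_n\in G$, there exists an algorithm which computes a finite group presentation of the subgroup $H=\langle h_1,\ldots,h_n\rangle$ of $G$ (not necessarily with respect to the generating set $\{h_1,\ldots,h_n\}$).
   Context: Setting: $G=G_1\ast_A G_2$ is a free product with amalgamation of finite groups $G_1=\langle X_1\mid R_1\rangle$ and $G_2=\langle X_2\mid R_2\rangle$, given by finite presentations with $X_1^{\pm}\cap X_2^{\pm}=\emptyset$, along a group $A=\langle Y\rangle$ with monomorphisms $\phi_i:A\to G_i$ ($i=1,2$), so $G=\langle X_1\cup X_2\mid R_1,R_2,\phi_1(a)=\phi_2(a)\ (a\in Y)\rangle$. All this data (including the Cayley graphs and relative Cayley graphs of $G_1,G_2$) is fixed and given. The input of the algorithm is the finite list $h_1,\ldots,h_n$, given as words over $(X_1\cup X_2)^{\pm}$. *)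

(* Defs.v *)
From mathcomp Require Import all_boot all_fingroup.

Set Implicit Arguments.
Unset Strict Implicit.
Unset Printing Implicit Defensive.

(* The letter (x, false) stands for x and (x, true) for its formal inverse. *)
Definition word (X : Type) := seq (X * bool).

Definition word_inv (X : Type) (w : word X) : word X :=
  rev [seq (l.1, ~~ l.2) | l <- w].

Definition word_map (X Z : Type) (f : X -> Z) (w : word X) : word Z :=
  [seq (f l.1, l.2) | l <- w].

Definition word_val (G : groupType) (X : Type) (gen : X -> G) (w : word X) : G :=
  (\prod_(l <- w) (if l.2 then (gen l.1)^-1 else gen l.1))%g.

(* The congruence on words whose quotient is the group <X | R>. *)
Inductive pres_eq (X : eqType) (R : seq (word X)) : word X -> word X -> Prop :=
| pres_eq_refl u : pres_eq R u u
| pres_eq_sym u v : pres_eq R u v -> pres_eq R v u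
| pres_eq_trans u v w : pres_eq R u v -> pres_eq R v w -> pres_eq R u w
| pres_eq_cat u u' v v' :
    pres_eq R u u' -> pres_eq R v v' -> pres_eq R (u ++ v) (u' ++ v')
| pres_eq_cancel x b : pres_eq R [:: (x, b); (x, ~~ b)] [::]
| pres_eq_rel r : r \in R -> pres_eq R r [::].

Inductive subgroup_gen (G : groupType) (S : G -> Prop) : G -> Prop :=
| subgroup_gen_in g : S g -> subgroup_gen S g
| subgroup_gen_1 : subgroup_gen S 1%g
| subgroup_gen_mul g h : subgroup_gen S g -> subgroup_gen S h -> subgroup_gen S (g * h)%g
| subgroup_gen_inv g : subgroup_gen S g -> subgroup_gen S (g^-1)%g.

Definition image_of (X Z : Type) (f : X -> Z) : Z -> Prop :=
  fun z => exists x, z = f x.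

(* <X | R> is a presentation of the subgroup H of G, the letter x naming the
   element gen x: the map from the free group on X to G induced by gen has
   image H, and its kernel is the normal closure of R. *)
Definition presents (G : groupType) (H : G -> Prop) (X : eqType)
    (gen : X -> G) (R : seq (word X)) : Prop :=
  (forall g, H g <-> subgroup_gen (image_of gen) g) /\
  (forall w, word_val gen w = 1%g <-> pres_eq R w [::]).

Definition whole (G : groupType) : G -> Prop := fun _ => True.

(* u1 y and u2 y are words representing phi1 and phi2 of the generator y of
   the amalgamated group; phi1 y = phi2 y is read as the relator
   (u1 y) (u2 y)^-1. *)
Definition amalgam_rels (X1 X2 Y : finType) (R1 : seq (word X1))
    (R2 : seq (word X2)) (u1 : Y -> word X1) (u2 : Y -> word X2) :
    seq (word (X1 + X2)%type) :=
  [seq word_map inl r | r <- R1] ++ [seq word_map inr r | r <- R2] ++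
  [seq word_map inl (u1 y) ++ word_inv (word_map inr (u2 y)) | y <- enum Y].

(* Total recursive functions on the natural numbers; minimization is applied
   only when it produces a total function. Each clause describes the new
   function pointwise, so that the class is closed under extensional
   equality. *)
Inductive recursive : forall k, (k.-tuple nat -> nat) -> Prop :=
| recursive_zero k (h : k.-tuple nat -> nat) :
    (forall v, h v = 0) -> recursive h
| recursive_succ (h : 1.-tuple nat -> nat) :
    (forall v, h v = (thead v).+1) -> recursive h
| recursive_proj k (i : 'I_k) (h : k.-tuple nat -> nat) :
    (forall v, h v = tnth v i) -> recursive h
| recursive_comp k m (f : m.-tuple nat -> nat)
    (g : 'I_m -> k.-tuple nat -> nat) (h : k.-tuple nat -> nat) :
    recursive f -> (forall i, recursive (g i)) ->
    (forall v, h v = f [tuple g i v | i < m]) -> recursive h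
| recursive_prim k (f : k.-tuple nat -> nat) (g : k.+2.-tuple nat -> nat)
    (h : k.+1.-tuple nat -> nat) :
    recursive f -> recursive g ->
    (forall v : k.-tuple nat, h [tuple of 0 :: v] = f v) ->
    (forall n (v : k.-tuple nat), h [tuple of n.+1 :: v] =
                 g [tuple of n :: h [tuple of n :: v] :: v]) ->
    recursive h
| recursive_min k (f : k.+1.-tuple nat -> nat) (h : k.-tuple nat -> nat) :
    recursive f ->
    (forall v : k.-tuple nat, f [tuple of h v :: v] = 0) ->
    (forall (v : k.-tuple nat) n, n < h v -> f [tuple of n :: v] != 0) ->
    recursive h.

(* Computability through the codes pickle. It is meant for types built from
   finite types and nat by pairs, sums, sequences and the like, on which pickle
   is an effective coding (on a finite type it is a finite table). *)
Definition computable (T1 T2 : countType) (f : T1 -> T2) : Prop :=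
  exists2 F : 1.-tuple nat -> nat,
    recursive F & forall x, F [tuple pickle x] = pickle (f x).

(* A finite presentation, together with m words over X that express its m
   generators. *)
Definition sub_presentation (X : Type) :=
  {m : nat & (m.-tuple (word X) * seq (word 'I_m))%type}.

Definition sub_presents (G : groupType) (X : Type) (gen : X -> G)
    (H : G -> Prop) (P : sub_presentation X) : Prop :=
  let: existT m (gens, rels) := P in
  presents H (fun i : 'I_m => word_val gen (tnth gens i)) rels.

(* Main.v *)
(* The algorithm is an unbounded search for a certificate that is decidable to
   check, sound, and available for every input.

   A certificate is a finite graph with edges labelled by elements of G1 and G2
   (a finite piece of the coset graph of H), each edge carrying a word in the
   proposed generators of H, together with a list of relators true in G that
   make these words multiplicative along edges of one colour and compatible with
   A at the vertices meeting both colours.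

   Soundness: write the label of a loop in normal form in the amalgam, one
   syllable at a time. Each rewriting step moves the path inside the graph, the
   two-coloured vertices being closed under A, and changes the carried word only
   by relators. A loop whose label is 1 in G therefore carries a consequence of
   the relators.

   Existence: take the cosets Hp and HpG1, HpG2 for the prefixes p of the given
   words h_i, and attach to each edge its Schreier generator. *)
Require Import Defs.
From Stdlib Require Import Setoid Morphisms.
From mathcomp Require Import all_boot all_fingroup.
From mathcomp Require Import boolp.

Set Implicit Arguments.
Unset Strict Implicit.
Unset Printing Implicit Defensive.

(** * Recursive functions *)

(** The obstacle is the kernel condition: every loop that is trivial in G must carry a consequence
    of the relators, although only finitely many checks are made. Normal forms are therefore
    computed by an action on states (van der Waerden's argument) that reads a path one label at a
    time. The same function [run] decides triviality inside the checker and is the induction along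
    which the soundness proof moves paths in the graph.

    Labels are whole elements of a factor rather than letters, so a syllable is one edge and a
    multiplication inside a syllable costs one relator. Both factors sit in one finite group [D]
    with retractions [io b], so labels have a single type and every operation on them is a finite
    table, even when it is defined by classical choice.

    Two dangers are balanced. Too few relators would present a group that is too large; the closing
    conditions on the graph exclude this. Too many would present one that is too small; each relator
    is therefore tested for truth in G by [run]. *)

(* Environments are lists read with default 0, so that one function serves all
   arities. *)
Definition env_recursive (f : seq nat -> nat) :=
  forall k, recursive (fun v : k.-tuple nat => f v).

(** Composing with the projections leaves the arguments unchanged, and the composition clause fixes
    its result only pointwise. *)
Lemma env_recursive_ext f g : f =1 g -> env_recursive f -> env_recursive g.
Proof.
move=> fg Rf k; apply: (@recursive_comp k k (fun v => f v)
  (fun i v => tnth v i)) => [|i|v]; first exact: Rf.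
  exact: (@recursive_proj _ i).
by rewrite -fg; congr f; congr val; apply: eq_from_tnth => i; rewrite tnth_mktuple.
Qed.

Lemma env_recursive0 : env_recursive (fun=> 0).
Proof. by move=> k; apply: recursive_zero. Qed.

Lemma env_recursive_var i : env_recursive (fun e => nth 0 e i).
Proof.
move=> k; case: (ltnP i k) => ik.
  by apply: (@recursive_proj _ (Ordinal ik)) => v; rewrite (tnth_nth 0).
by apply: recursive_zero => v; rewrite nth_default // size_tuple.
Qed.

Lemma env_recursive_comp f (gs : seq (seq nat -> nat)) :
  env_recursive f -> (forall i, env_recursive (nth (fun=> 0) gs i)) ->
  env_recursive (fun e => f [seq g e | g <- gs]).
Proof.
move=> Rf Rg k.
apply: (@recursive_comp k (size gs) (fun v => f v)
  (fun i v => nth (fun=> 0) gs i v)) => [|i|v]; [exact: Rf|exact: Rg|].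
congr f; apply: (@eq_from_nth _ 0) => [|i]; first by rewrite size_tuple size_map.
rewrite size_map => lt_i.
rewrite (nth_map (fun=> 0)) //.
by rewrite -[i in RHS]/(val (Ordinal lt_i)) -tnth_nth tnth_mktuple.
Qed.

Lemma env_recursive_succ f : env_recursive f -> env_recursive (fun e => (f e).+1).
Proof.
move=> Rf k; apply: (@recursive_comp k 1 (fun v => (thead v).+1) (fun _ v => f v)).
- exact: recursive_succ.
- by move=> _; apply: Rf.
by move=> v; rewrite /thead tnth_mktuple.
Qed.

Lemma env_recursive_const n : env_recursive (fun=> n).
Proof. by elim: n => [|n IHn]; [apply: env_recursive0|apply: env_recursive_succ]. Qed.

(** The environment form of a local binding: the value of [n] becomes variable 0 and the other
    variables shift by one. *)
Lemma env_recursive_push f n : env_recursive f -> env_recursive n ->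
  env_recursive (fun e => f (n e :: e)).
Proof.
move=> Rf Rn k; apply: (@recursive_comp k k.+1 (fun v => f v)
  (fun i v => if unlift ord0 i is Some j then tnth v j else n v)) => [|i|v].
- exact: Rf.
- case: unliftP => [j _|_]; [exact: (@recursive_proj _ j)|exact: Rn].
congr f; have -> : n v :: v = [tuple of n v :: v] by [].
congr val; apply: eq_from_tnth => i; rewrite tnth_mktuple.
by case: unliftP => [j ->|->]; rewrite ?tnthS ?tnth0.
Qed.

Lemma env_recursive_behead f :
  env_recursive f -> env_recursive (fun e => f (behead e)).
Proof.
move=> Rf [|k].
  apply: (@recursive_comp 0 0 (fun v => f v) (fun i v => tnth v i)) => [|i|v].
  - exact: Rf.
  - exact: (@recursive_proj _ i).
  by congr f; rewrite (tuple0 v) (tuple0 [tuple _ | _ < _]).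
apply: (@recursive_comp k.+1 k (fun v => f v) (fun i v => tnth v (lift ord0 i))).
- exact: Rf.
- by move=> i; exact: (@recursive_proj _ (lift ord0 i)).
case/tupleP=> n v; congr f; rewrite [LHS]/=.
by congr tval; apply: eq_from_tnth => i; rewrite tnth_mktuple tnthS.
Qed.

Fixpoint primrec (z : nat) (s : nat -> nat -> nat) n :=
  if n is n'.+1 then s n' (primrec z s n') else z.

Lemma env_recursive_primrec n z s :
  env_recursive n -> env_recursive z ->
  env_recursive (fun e => s (nth 0 e 0) (nth 0 e 1) (behead (behead e))) ->
  env_recursive (fun e => primrec (z e) (fun i a => s i a e) (n e)).
Proof.
move=> Rn Rz Rs.
(* The counter is made variable 0 of an extended environment, the shape of the recursion clause. At
   arity 0 this variable reads the default 0, so the recursion stops at [z]. *)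
have := @env_recursive_push (fun e =>
  primrec (z (behead e)) (fun i a => s i a (behead e)) (nth 0 e 0)) n.
apply=> // -[|k].
  apply: (@recursive_comp 0 0 (fun v => z v) (fun i v => tnth v i)) => [|i|v].
  - exact: Rz.
  - exact: (@recursive_proj _ i).
  by rewrite (tuple0 v) (tuple0 [tuple _ | _ < _]).
apply: (@recursive_prim k (fun v => z v)
  (fun v => s (nth 0 v 0) (nth 0 v 1) (behead (behead v)))) => //.
Qed.

Lemma env_recursive_min f h : env_recursive f ->
  (forall e, f (h e :: e) = 0) -> (forall e n, n < h e -> f (n :: e) != 0) ->
  env_recursive h.
Proof.
move=> Rf f0 fn k; apply: (@recursive_min k (fun v => f v)) => [|v|v n] /=.
- exact: Rf.
- exact: f0.
- exact: fn.
Qed.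

Lemma env_recursive1 F a : env_recursive (fun e => F (nth 0 e 0)) ->
  env_recursive a -> env_recursive (fun e => F (a e)).
Proof.
move=> RF Ra; apply: (@env_recursive_comp (fun e => F (nth 0 e 0)) [:: a] RF).
by case=> [|i] //=; rewrite nth_nil; apply: env_recursive0.
Qed.

Lemma env_recursive_iter F n a : env_recursive (fun e => F (nth 0 e 0)) ->
  env_recursive n -> env_recursive a -> env_recursive (fun e => iter (n e) F (a e)).
Proof.
move=> RF Rn Ra.
have: env_recursive (fun e => primrec (a e) (fun _ x => F x) (n e)).
  apply: (@env_recursive_primrec n a (fun _ x _ => F x)) => //.
  exact: env_recursive1 (env_recursive_var 1).
by apply: env_recursive_ext => e; elim: (n e) => //= m ->.
Qed.

Lemma env_recursive_if c a b : env_recursive c -> env_recursive a ->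
  env_recursive b -> env_recursive (fun e => if c e is 0 then a e else b e).
Proof.
move=> Rc Ra Rb.
(* Recursion whose step ignores the accumulator is a case distinction on zero. *)
have: env_recursive (fun e => primrec (a e) (fun _ _ => b e) (c e)).
  apply: (@env_recursive_primrec c a (fun _ _ e => b e)) => //.
  exact: (@env_recursive_behead (fun e => b (behead e)) (env_recursive_behead Rb)).
by apply: env_recursive_ext => e; case: (c e).
Qed.

Lemma env_recursive_add a b : env_recursive a -> env_recursive b ->
  env_recursive (fun e => a e + b e).
Proof.
move=> Ra Rb; have: env_recursive (fun e => iter (a e) succn (b e)).
  by apply: env_recursive_iter => //; apply: env_recursive_succ (env_recursive_var 0).
by apply: env_recursive_ext => e; rewrite iter_succn addnC.
Qed.

Lemma env_recursive_pred a : env_recursive a -> env_recursive (fun e => (a e).-1).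
Proof.
move=> Ra; have: env_recursive (fun e => primrec 0 (fun i _ => i) (a e)).
  apply: (@env_recursive_primrec a (fun=> 0) (fun i _ _ => i)) => //.
    exact: env_recursive0.
  exact: env_recursive_var.
by apply: env_recursive_ext => e; case: (a e).
Qed.

Lemma env_recursive_sub a b : env_recursive a -> env_recursive b ->
  env_recursive (fun e => a e - b e).
Proof.
move=> Ra Rb; have: env_recursive (fun e => iter (b e) predn (a e)).
  by apply: env_recursive_iter => //; apply: env_recursive_pred (env_recursive_var 0).
by apply: env_recursive_ext => e; rewrite iter_predn.
Qed.

Lemma env_recursive_leq a b : env_recursive a -> env_recursive b ->
  env_recursive (fun e => a e <= b e).
Proof.
move=> Ra Rb; have: env_recursive (fun e => if a e - b e is 0 then 1 else 0).
  apply: env_recursive_if; [exact: env_recursive_sub|exact: env_recursive_const..].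
by apply: env_recursive_ext => e; rewrite /leq; case: (_ - _).
Qed.

Lemma env_recursive_eq a b : env_recursive a -> env_recursive b ->
  env_recursive (fun e => a e == b e).
Proof.
move=> Ra Rb.
have: env_recursive (fun e => if (a e <= b e) : nat is 0 then 0 else b e <= a e).
  by apply: env_recursive_if; [exact: env_recursive_leq|exact: env_recursive_const|
    exact: env_recursive_leq].
by apply: env_recursive_ext => e; rewrite eqn_leq; case: (_ <= _).
Qed.

(** The recurrence x(i+1) = i - x(i) from x(0) = 0 produces the halves, because the half of i+1 is
    [uphalf i], which is i minus the half of i. *)
Lemma env_recursive_half a : env_recursive a -> env_recursive (fun e => (a e)./2).
Proof.
move=> Ra; have: env_recursive (fun e => primrec 0 (fun i x => i - x) (a e)).
  apply: (@env_recursive_primrec a (fun=> 0) (fun i x _ => i - x)) => //.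
    exact: env_recursive0.
  exact: (env_recursive_sub (env_recursive_var 0) (env_recursive_var 1)).
apply: env_recursive_ext => e; elim: (a e) => //= n ->.
by rewrite uphalf_half -{1}(odd_double_half n) -addnn addnA addnK.
Qed.

Lemma env_recursive_odd a : env_recursive a -> env_recursive (fun e => odd (a e)).
Proof.
move=> Ra; have: env_recursive (fun e => iter (a e) (fun x => 1 - x) 0).
  apply: env_recursive_iter => //; last exact: env_recursive0.
  exact: (env_recursive_sub (env_recursive_const 1) (env_recursive_var 0)).
by apply: env_recursive_ext => e; elim: (a e) => //= n ->; case: odd.
Qed.

(** * Arithmetic of the coding of lists *)

Definition code_cons n c := 2 ^ n * c.*2.+1.
(** On the code of a nonempty list this is the exponent of 2, and the odd part 2c+1 carries the code
    c of the tail. The empty list has code 0. *)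
Definition code_head c := head 0 (CodeSeq.decode c).
Definition code_tail c := CodeSeq.code (behead (CodeSeq.decode c)).

Lemma env_recursive_code_cons a b : env_recursive a -> env_recursive b ->
  env_recursive (fun e => code_cons (a e) (b e)).
Proof.
move=> Ra Rb.
have: env_recursive (fun e => iter (a e) double (b e).*2.+1).
  apply: env_recursive_iter => //.
    apply: env_recursive_ext (env_recursive_add (env_recursive_var 0) (env_recursive_var 0)).
    by move=> e; rewrite addnn.
  apply: env_recursive_succ; apply: env_recursive_ext (env_recursive_add Rb Rb).
  by move=> e; rewrite addnn.
apply: env_recursive_ext => e; rewrite /code_cons.
by elim: (a e) => [|n /= ->]; rewrite ?mul1n // expnS -mulnA mul2n.
Qed.

Lemma iter_half_code n c i : i <= n -> iter i half (code_cons n c) = code_cons (n - i) c.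
Proof.
elim: i => [|i IHi] lt_in; first by rewrite subn0.
rewrite iterS IHi; last exact: ltnW.
rewrite -subnSK //= /code_cons expnS -mulnA mul2n doubleK //.
Qed.

Lemma env_recursive_code_head a : env_recursive a ->
  env_recursive (fun e => code_head (a e)).
Proof.
move=> Ra; apply: env_recursive1 Ra.
(* The head is the least i for which halving i times gives an odd number. Code 0 never becomes odd,
   so it is accepted at once to keep the minimization total. *)
pose f (e : seq nat) := if nth 0 e 1 is 0 then 0 else
  1 - odd (iter (nth 0 e 0) half (nth 0 e 1)).
have fE i e : f (i :: e) = (nth 0 e 0 != 0) && ~~ odd (iter i half (nth 0 e 0)).
  by rewrite /f /=; case: (nth 0 e 0) => //= n; case: odd.
apply: (@env_recursive_min f); rewrite /f.
- apply: env_recursive_if.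
  + exact: env_recursive_var.
  + exact: env_recursive0.
  apply: env_recursive_sub; first exact: env_recursive_const.
  apply: env_recursive_odd; apply: env_recursive_iter; try exact: env_recursive_var.
  exact: env_recursive_half (env_recursive_var 0).
- move=> e; rewrite -/(f _) fE; set c := nth 0 e 0.
  rewrite -(CodeSeq.decodeK c) /code_head CodeSeq.codeK.
  case: (CodeSeq.decode c) => //= n s; rewrite -/(code_cons _ _).
  by rewrite iter_half_code // subnn /code_cons mul1n /= odd_double andbF.
move=> e n; rewrite -/(f _) fE; set c := nth 0 e 0.
rewrite -(CodeSeq.decodeK c) /code_head CodeSeq.codeK.
case: (CodeSeq.decode c) => //= m s lt_nm; rewrite -/(code_cons _ _).
rewrite iter_half_code 1?ltnW // /code_cons muln_eq0 expn_eq0 /= oddM oddX.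
by rewrite subn_eq0 leqNgt lt_nm.
Qed.

Lemma env_recursive_code_tail a : env_recursive a ->
  env_recursive (fun e => code_tail (a e)).
Proof.
(* The first halvings leave the odd part 2c+1, and one more leaves c. *)
move=> Ra; have: env_recursive (fun e => iter (code_head (a e)).+1 half (a e)).
  apply: env_recursive_iter => //; first exact: env_recursive_half (env_recursive_var 0).
  exact: env_recursive_succ (env_recursive_code_head _).
apply: env_recursive_ext => e.
rewrite /code_head /code_tail -{2}(CodeSeq.decodeK (a e)).
case: (CodeSeq.decode _) => //= n s; rewrite -/(code_cons _ _).
by rewrite iter_half_code // subnn /code_cons mul1n /= uphalf_double.
Qed.

(** * Computable functions on pickled types *)

Lemma computableP (T U : countType) (f : T -> U) :
  computable f <->
  exists2 F : nat -> nat, env_recursive (fun e => F (nth 0 e 0)) &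
    forall x, F (pickle x) = pickle (f x).
Proof.
split=> [[F RF Ff]|[F RF Ff]].
  exists (fun n => F [tuple n]) => // k.
  apply: (@recursive_comp k 1 F (fun _ v => nth 0 v 0)) => // [_|v].
    exact: env_recursive_var.
  by congr F; apply: val_inj; rewrite /= enum_ordSl enum_ord0.
exists (fun v => F (nth 0 v 0)) => //; exact: RF.
Qed.

Lemma computable_ext (T U : countType) (f g : T -> U) :
  f =1 g -> computable f -> computable g.
Proof. by move=> fg [F RF Ff]; exists F => // x; rewrite Ff fg. Qed.

Lemma computable_id (T : countType) : computable (@id T).
Proof. by apply/computableP; exists id => //; apply: env_recursive_var. Qed.

Lemma computable_const (T U : countType) (u : U) : computable (fun _ : T => u).
Proof.
by apply/computableP; exists (fun=> pickle u) => //; apply: env_recursive_const.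
Qed.

Lemma computable_comp (S T U : countType) (g : T -> U) (f : S -> T) :
  computable g -> computable f -> computable (fun x => g (f x)).
Proof.
move=> /computableP[G RG Gg] /computableP[F RF Ff]; apply/computableP.
exists (fun n => G (F n)) => [|x]; first exact: env_recursive1.
by rewrite Ff Gg.
Qed.

Definition code_pair m n := code_cons m (code_cons n 0).

Lemma env_recursive_code_pair a b : env_recursive a -> env_recursive b ->
  env_recursive (fun e => code_pair (a e) (b e)).
Proof.
move=> Ra Rb; apply: env_recursive_code_cons => //.
by apply: env_recursive_code_cons => //; apply: env_recursive0.
Qed.

Lemma pickle_pair (T U : countType) (x : T) (y : U) :
  pickle (x, y) = code_pair (pickle x) (pickle y).
Proof. by []. Qed.

Lemma pickle_cons (T : countType) (x : T) s :
  pickle (x :: s) = code_cons (pickle x) (pickle s).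
Proof. by []. Qed.

Lemma code_headK m n : code_head (code_cons m n) = m.
Proof.
by rewrite /code_head -[n]CodeSeq.decodeK (CodeSeq.codeK (m :: _)).
Qed.

Lemma code_tailK m n : code_tail (code_cons m n) = n.
Proof.
by rewrite /code_tail -{1}[n]CodeSeq.decodeK (CodeSeq.codeK (m :: _)) CodeSeq.decodeK.
Qed.

Lemma code_cons_gt0 m n : 0 < code_cons m n.
Proof. by rewrite muln_gt0 expn_gt0. Qed.

Lemma computable_pair (T U V : countType) (f : T -> U) (g : T -> V) :
  computable f -> computable g -> computable (fun x => (f x, g x)).
Proof.
move=> /computableP[F RF Ff] /computableP[G RG Gg]; apply/computableP.
exists (fun n => code_pair (F n) (G n)) => [|x]; first exact: env_recursive_code_pair.
by rewrite Ff Gg pickle_pair.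
Qed.

Lemma computable_fst (T U V : countType) (f : T -> U * V) :
  computable f -> computable (fun x => (f x).1).
Proof.
move=> /computableP[F RF Ff]; apply/computableP.
exists (fun n => code_head (F n)) => [|x]; first exact: env_recursive_code_head.
by rewrite Ff; case: (f x) => y z; rewrite pickle_pair code_headK.
Qed.

Lemma computable_snd (T U V : countType) (f : T -> U * V) :
  computable f -> computable (fun x => (f x).2).
Proof.
move=> /computableP[F RF Ff]; apply/computableP.
exists (fun n => code_head (code_tail (F n))) => [|x].
  exact/env_recursive_code_head/env_recursive_code_tail.
by rewrite Ff; case: (f x) => y z; rewrite pickle_pair code_tailK code_headK.
Qed.

Lemma computable_cons (T U : countType) (f : T -> U) (s : T -> seq U) :
  computable f -> computable s -> computable (fun x => f x :: s x).
Proof.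
move=> /computableP[F RF Ff] /computableP[G RG Gg]; apply/computableP.
exists (fun n => code_cons (F n) (G n)) => [|x]; first exact: env_recursive_code_cons.
by rewrite Ff Gg pickle_cons.
Qed.

Lemma computable_case (T A U : countType) (s : T -> seq A) (z : T -> U)
    (g : T -> A -> seq A -> U) :
  computable s -> computable z ->
  computable (fun p : T * (A * seq A) => g p.1 p.2.1 p.2.2) ->
  computable (fun x => if s x is a :: l then g x a l else z x).
Proof.
move=> /computableP[S RS Ss] /computableP[Z RZ Zz] /computableP[G RG Gg].
apply/computableP; exists (fun n => if S n is 0 then Z n else
  G (code_pair n (code_pair (code_head (S n)) (code_tail (S n))))) => [|x].
  apply: env_recursive_if => //; apply: env_recursive1 => //.
  apply: env_recursive_code_pair; first exact: env_recursive_var.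
  by apply: env_recursive_code_pair;
    [apply: env_recursive_code_head|apply: env_recursive_code_tail].
rewrite Ss; case: (s x) => [|a l]; first by rewrite Zz.
(* A nonempty list has a positive code, so the test against 0 separates it from the empty list. *)
rewrite pickle_cons; case E: code_cons (code_cons_gt0 (pickle a) (pickle l)) => // _.
by rewrite -E code_headK code_tailK -!pickle_pair Gg.
Qed.

Lemma iter_code_tail (T : countType) (s : seq T) i :
  iter i code_tail (pickle s) = pickle (drop i s).
Proof.
elim: i => [|i IHi]; first by rewrite drop0.
rewrite iterS IHi -addn1 addnC -drop_drop.
by case: (drop i s) => [|a l] //=; rewrite drop0 pickle_cons code_tailK.
Qed.

(** This lets the code of a list serve as the loop bound in [computable_foldl]. *)
Lemma size_le_pickle (T : countType) (s : seq T) : size s <= pickle s.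
Proof.
elim: s => //= a s IHs; rewrite pickle_cons /code_cons.
apply: (@leq_trans (pickle s).*2.+1); last by rewrite leq_pmull ?expn_gt0.
by rewrite ltnS -addnn (leq_trans IHs) // leq_addr.
Qed.

Lemma computable_foldl (T A U : countType) (f : T -> U -> A -> U) (z : T -> U)
    (s : T -> seq A) :
  computable s -> computable z ->
  computable (fun p : T * (U * A) => f p.1 p.2.1 p.2.2) ->
  computable (fun x => foldl (f x) (z x) (s x)).
Proof.
move=> /computableP[S RS Ss] /computableP[Z RZ Zz] /computableP[G RG Gg].
(* Round i consumes the head of the i-th tail. There are as many rounds as the value of the code;
   those past the end of the list see code 0 and keep the accumulator. *)
pose F n i a := if iter i code_tail (S n) is 0 then a else
  G (code_pair n (code_pair a (code_head (iter i code_tail (S n))))).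
apply/computableP; exists (fun n => primrec (Z n) (F n) (S n)) => [|x].
  apply: (@env_recursive_primrec (fun e => S (nth 0 e 0)) (fun e => Z (nth 0 e 0))
    (fun i a e => F (nth 0 e 0) i a)) => //.
  have R2 : env_recursive (fun e => nth 0 (behead (behead e)) 0).
    by apply: env_recursive_ext (env_recursive_var 2) => e; rewrite !nth_behead.
  have Ri: env_recursive (fun e =>
      iter (nth 0 e 0) code_tail (S (nth 0 (behead (behead e)) 0))).
    apply: env_recursive_iter.
    - exact: env_recursive_code_tail (env_recursive_var 0).
    - exact: env_recursive_var.
    - exact: env_recursive1 R2.
  apply: env_recursive_if => //; first exact: env_recursive_var.
  apply: env_recursive1 RG _; apply: env_recursive_code_pair => //.
  apply: env_recursive_code_pair; first exact: env_recursive_var.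
  exact: env_recursive_code_head.
have E k : primrec (Z (pickle x)) (F (pickle x)) k =
    pickle (foldl (f x) (z x) (take k (s x))).
  elim: k => [|k /= ->]; first by rewrite take0 Zz.
  rewrite /F Ss iter_code_tail; case: (ltnP k (size (s x))) => ks; last first.
    by rewrite drop_oversize ?take_oversize // leqW.
  case Ed: (drop k (s x)) => [|a l].
    by move: (size_drop k (s x)); rewrite Ed => /esym/eqP; rewrite subn_eq0 leqNgt ks.
  rewrite pickle_cons; case E: code_cons (code_cons_gt0 (pickle a) (pickle l)) => // _.
  rewrite -E code_headK -!pickle_pair Gg /= (take_nth a) // -cats1 foldl_cat /=.
  by rewrite -[k]addn0 -nth_drop Ed.
by rewrite E Ss take_oversize // size_le_pickle.
Qed.

Lemma computable_finfun (T : finType) (U : countType) (f : T -> U) : computable f.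
Proof.
(* A finite table, searched by comparing codes. The table is fixed, so [f] may come from classical
   choice. *)
pose F n := foldr (fun x c => if (n == pickle x)%N : nat is 0 then c else pickle (f x))
  0 (enum T).
apply/computableP; exists F => [|x].
  rewrite /F; elim: (enum T) => [|y s IHs] /=; first exact: env_recursive0.
  apply: env_recursive_if => //; last exact: env_recursive_const.
  by apply: env_recursive_eq; [apply: env_recursive_var|apply: env_recursive_const].
rewrite /F; have: x \in enum T by rewrite mem_enum.
elim: (enum T) => //= y s IHs.
rewrite inE (inj_eq (pcan_inj pickleK)).
by case: eqP => [->|_ /IHs].
Qed.

Lemma computable_fin (S : countType) (T : finType) (U : countType) (h : T -> U)
    (f : S -> T) : computable f -> computable (fun x => h (f x)).
Proof. exact/computable_comp/computable_finfun. Qed.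

Lemma computable_fin2 (S : countType) (A B : finType) (U : countType)
    (h : A -> B -> U) (f : S -> A) (g : S -> B) :
  computable f -> computable g -> computable (fun x => h (f x) (g x)).
Proof.
move=> cf cg.
exact: (computable_fin (fun p => h p.1 p.2) (computable_pair cf cg)).
Qed.

Lemma computable_if (T U : countType) (b : T -> bool) (f g : T -> U) :
  computable b -> computable f -> computable g ->
  computable (fun x => if b x then f x else g x).
Proof.
move=> /computableP[B RB Bb] /computableP[F RF Ff] /computableP[G RG Gg].
apply/computableP; exists (fun n => if B n is 0 then G n else F n) => [|x].
  exact: env_recursive_if.
by rewrite Bb Ff Gg; case: (b x).
Qed.

Lemma computable_eq (T U : countType) (f g : T -> U) :
  computable f -> computable g -> computable (fun x => f x == g x).
Proof.
move=> /computableP[F RF Ff] /computableP[G RG Gg]; apply/computableP.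
exists (fun n => (F n == G n)%N) => [|x]; first exact: env_recursive_eq.
by rewrite Ff Gg (inj_eq (pcan_inj pickleK)); case: eqP.
Qed.

Lemma computable_leq (T : countType) (f g : T -> nat) :
  computable f -> computable g -> computable (fun x => f x <= g x).
Proof.
move=> /computableP[F RF Ff] /computableP[G RG Gg]; apply/computableP.
exists (fun n => (F n <= G n)%N) => [|x]; first exact: env_recursive_leq.
by rewrite Ff Gg; case: (_ <= _).
Qed.

Lemma computable_succ (T : countType) (f : T -> nat) :
  computable f -> computable (fun x => (f x).+1).
Proof.
move=> /computableP[F RF Ff]; apply/computableP.
by exists (fun n => (F n).+1) => [|x]; [apply: env_recursive_succ|rewrite Ff].
Qed.

Lemma computable_nth (T U : countType) (x0 : U) (s : T -> seq U) (i : T -> nat) :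
  computable s -> computable i -> computable (fun x => nth x0 (s x) (i x)).
Proof.
move=> /computableP[S RS Ss] /computableP[F RF Ff]; apply/computableP.
exists (fun n => if iter (F n) code_tail (S n) is 0 then pickle x0 else
  code_head (iter (F n) code_tail (S n))) => [|x].
  have Ri: env_recursive (fun e => iter (F (nth 0 e 0)) code_tail (S (nth 0 e 0))).
    by apply: env_recursive_iter => //; apply: env_recursive_code_tail (env_recursive_var 0).
  apply: env_recursive_if => //; first exact: env_recursive_const.
  exact: env_recursive_code_head.
rewrite Ss Ff iter_code_tail -[RHS]/(pickle (nth x0 (s x) (i x))).
have -> : nth x0 (s x) (i x) = nth x0 (drop (i x) (s x)) 0 by rewrite nth_drop addn0.
case: drop => [|a l] //=.
rewrite pickle_cons; case E: code_cons (code_cons_gt0 (pickle a) (pickle l)) => // _.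
by rewrite -E code_headK.
Qed.

Lemma computable_rev (T U : countType) (s : T -> seq U) :
  computable s -> computable (fun x => rev (s x)).
Proof.
move=> cs; have: computable (fun x => foldl (fun l a => a :: l) [::] (s x)).
  apply: (@computable_foldl _ _ _ (fun _ l a => a :: l)) => //.
    exact: computable_const.
  apply: computable_cons.
    exact/computable_snd/computable_snd/computable_id.
  exact/computable_fst/computable_snd/computable_id.
apply: computable_ext => x; rewrite -{1}[s x]revK foldl_rev.
by elim: (rev _) => //= a l ->.
Qed.

Lemma computable_foldr (T A U : countType) (f : T -> A -> U -> U) (z : T -> U)
    (s : T -> seq A) :
  computable s -> computable z ->
  computable (fun p : T * (A * U) => f p.1 p.2.1 p.2.2) ->
  computable (fun x => foldr (f x) (z x) (s x)).
Proof.
move=> cs cz cf.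
have: computable (fun x => foldl (fun u a => f x a u) (z x) (rev (s x))).
  apply: (@computable_foldl _ _ _ (fun x u a => f x a u)) => //.
    exact: computable_rev.
  apply: (computable_comp cf (f := fun p : T * (U * A) => (p.1, (p.2.2, p.2.1)))).
  apply: computable_pair; first exact/computable_fst/computable_id.
  apply: computable_pair.
    exact/computable_snd/computable_snd/computable_id.
  exact/computable_fst/computable_snd/computable_id.
by apply: computable_ext => x; rewrite foldl_rev.
Qed.

Lemma computable_map (T A B : countType) (f : T -> A -> B) (s : T -> seq A) :
  computable s -> computable (fun p : T * A => f p.1 p.2) ->
  computable (fun x => [seq f x a | a <- s x]).
Proof.
move=> cs cf; have: computable (fun x => foldr (fun a l => f x a :: l) [::] (s x)).
  apply: (@computable_foldr _ _ _ (fun x a l => f x a :: l)) => //.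
    exact: computable_const.
  apply: computable_cons; last exact/computable_snd/computable_snd/computable_id.
  apply: (computable_comp cf (f := fun p : T * (A * seq B) => (p.1, p.2.1))).
  apply: computable_pair; first exact/computable_fst/computable_id.
  exact/computable_fst/computable_snd/computable_id.
by apply: computable_ext.
Qed.

Lemma computable_all (T A : countType) (f : T -> A -> bool) (s : T -> seq A) :
  computable s -> computable (fun p : T * A => f p.1 p.2) ->
  computable (fun x => all (f x) (s x)).
Proof.
move=> cs cf; have: computable (fun x => foldr (fun a b => f x a && b) true (s x)).
  apply: (@computable_foldr _ _ _ (fun x a b => f x a && b)) => //.
    exact: computable_const.
  apply: (computable_fin2 andb); last exact/computable_snd/computable_snd/computable_id.
  apply: (computable_comp cf (f := fun p : T * (A * bool) => (p.1, p.2.1))).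
  apply: computable_pair; first exact/computable_fst/computable_id.
  exact/computable_fst/computable_snd/computable_id.
by apply: computable_ext.
Qed.

Lemma computable_has (T A : countType) (f : T -> A -> bool) (s : T -> seq A) :
  computable s -> computable (fun p : T * A => f p.1 p.2) ->
  computable (fun x => has (f x) (s x)).
Proof.
move=> cs cf; have: computable (fun x => ~~ all (fun a => ~~ f x a) (s x)).
  apply: (computable_fin negb).
  apply: (@computable_all _ _ (fun x a => ~~ f x a)) => //.
  exact: computable_fin cf.
by apply: computable_ext => x; rewrite -has_predC; apply: eq_has => a /=; rewrite negbK.
Qed.

Lemma computable_mem (T A : countType) (f : T -> A) (s : T -> seq A) :
  computable f -> computable s -> computable (fun x => f x \in s x).
Proof.
move=> cf cs; have: computable (fun x => has (fun a => a == f x) (s x)).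
  apply: (@computable_has _ _ (fun x a => a == f x)) => //.
  apply: computable_eq; first exact/computable_snd/computable_id.
  exact/(computable_comp cf)/computable_fst/computable_id.
by apply: computable_ext => x; rewrite has_pred1.
Qed.

Lemma computable_cat (T A : countType) (s t : T -> seq A) :
  computable s -> computable t -> computable (fun x => s x ++ t x).
Proof.
move=> cs ct; have: computable (fun x => foldr (fun a l => a :: l) (t x) (s x)).
  apply: (@computable_foldr _ _ _ (fun _ a l => a :: l)) => //.
  apply: computable_cons.
    exact/computable_fst/computable_snd/computable_id.
  exact/computable_snd/computable_snd/computable_id.
by apply: computable_ext => x; elim: (s x) => //= a l ->.
Qed.

Lemma computable_flatten (T A : countType) (s : T -> seq (seq A)) :
  computable s -> computable (fun x => flatten (s x)).
Proof.
move=> cs; apply: (@computable_foldr _ _ _ (fun _ => cat)) => //.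
  exact: computable_const.
apply: computable_cat.
  exact/computable_fst/computable_snd/computable_id.
exact/computable_snd/computable_snd/computable_id.
Qed.

Lemma computable_size (T A : countType) (s : T -> seq A) :
  computable s -> computable (fun x => size (s x)).
Proof.
move=> cs; have: computable (fun x => foldr (fun _ n => n.+1) 0 (s x)).
  apply: (@computable_foldr _ _ _ (fun _ _ n => n.+1)) => //.
    exact: computable_const.
  exact/computable_succ/computable_snd/computable_snd/computable_id.
by apply: computable_ext => x; elim: (s x) => //= a l ->.
Qed.

Lemma computable_iota0 (T A : countType) (s : T -> seq A) :
  computable s -> computable (fun x => iota 0 (size (s x))).
Proof.
move=> cs; have: computable (fun x => foldl (fun l _ => rcons l (size l)) [::] (s x)).
  apply: (@computable_foldl _ _ _ (fun _ l _ => rcons l (size l))) => //.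
    exact: computable_const.
  have cl : computable (fun p : T * (seq nat * A) => p.2.1).
    exact/computable_fst/computable_snd/computable_id.
  have := computable_cat cl (computable_cons (computable_size cl) (computable_const _ [::])).
  by apply: computable_ext => p; rewrite cats1.
apply: computable_ext => x; elim/last_ind: (s x) => //= l a IHl.
by rewrite -cats1 foldl_cat /= IHl size_iota cats1 size_rcons -addn1 iotaD add0n cats1.
Qed.

(** The search runs over all natural numbers and must recognize codes before the checker is applied,
    since the function realizing the checker is arbitrary on numbers that code nothing. *)
Definition decidable_codes (T : countType) :=
  exists2 V : nat -> bool, computable V & forall n, V n <-> exists x : T, pickle x = n.

Lemma decidable_codes_nat : decidable_codes nat.
Proof.
exists xpredT; first exact: computable_const.
by move=> n; split=> // _; exists n.
Qed.

Lemma decidable_codes_fin (T : finType) : decidable_codes T.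
Proof.
exists (fun n => n \in [seq pickle x | x : T]) => [|n].
  by apply: computable_mem; [apply: computable_id|apply: computable_const].
by split=> [/imageP[x _ ->]|[x <-]]; [exists x|apply: image_f].
Qed.

Lemma computable_decode : computable CodeSeq.decode.
Proof.
(* A number and the list it decodes to have the same code. *)
apply/computableP; exists id => [|n]; first exact: env_recursive_var.
have -> : pickle (CodeSeq.decode n) = CodeSeq.code (map id (CodeSeq.decode n)) by [].
by rewrite map_id CodeSeq.decodeK.
Qed.

Lemma decidable_codes_seq (T : countType) :
  decidable_codes T -> decidable_codes (seq T).
Proof.
case=> V cV VP; exists (fun n => all V (CodeSeq.decode n)) => [|n].
  apply: (@computable_all _ _ (fun _ => V)); first exact: computable_decode.
  exact/(computable_comp cV)/computable_snd/computable_id.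
split=> [Vn|[s <-]]; last first.
  by rewrite CodeSeq.codeK all_map; apply/allP => x _; apply/VP; exists x.
suff [s sE]: exists s : seq T, map pickle s = CodeSeq.decode n.
  by exists s; rewrite -[n]CodeSeq.decodeK -sE.
elim: (CodeSeq.decode n) Vn => [|k l IHl] /=; first by exists [::].
by case/andP=> /VP[x <-] /IHl[s <-]; exists (x :: s).
Qed.

Lemma decidable_codes_pair (T U : countType) :
  decidable_codes T -> decidable_codes U -> decidable_codes (T * U)%type.
Proof.
case=> V cV VP [W cW WP].
exists (fun n => (V (nth 0 (CodeSeq.decode n) 0) && W (nth 0 (CodeSeq.decode n) 1)) &&
  (size (CodeSeq.decode n) == 2)) => [|n].
  apply: (computable_fin2 andb); last first.
    apply: computable_eq; last exact: computable_const.
    exact: computable_size computable_decode.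
  by apply: (computable_fin2 andb);
    [apply: (computable_comp cV)|apply: (computable_comp cW)];
    apply: computable_nth; [apply: computable_decode|apply: computable_const|
      apply: computable_decode|apply: computable_const].
have decE (x : T) (y : U) :
    pickle (x, y) = n <-> CodeSeq.decode n = [:: pickle x; pickle y].
  split=> [<-|E]; first exact: CodeSeq.codeK.
  by rewrite -[n]CodeSeq.decodeK E.
move: (CodeSeq.decode n) decE => [|k [|l [|m s]]] decE /=; rewrite ?andbF ?andbT.
- by split=> // -[[x y]] /decE.
- by split=> // -[[x y]] /decE.
- split=> [/andP[/VP[x xk] /WP[y yl]]|[[x y] /decE[kx ly]]].
    by exists (x, y); apply/decE; rewrite xk yl.
  by apply/andP; split; [apply/VP; exists x|apply/WP; exists y].
by split=> // -[[x y]] /decE.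
Qed.

Lemma computable_search (T U : countType) (check : T -> U -> bool) :
  decidable_codes T -> decidable_codes U ->
  computable (fun p : T * U => check p.1 p.2) ->
  (forall x, exists y, check x y) ->
  exists2 f : T -> U, computable f & forall x, check x (f x).
Proof.
case=> V /computableP[V' RV V'E] VP [W /computableP[W' RW W'E] WP].
case/computableP=> C RC CE checkT.
(* An input that is no code passes immediately, which keeps the minimization total; a candidate that
   is no code fails. *)
pose test c n := if V' c is 0 then 0 else if W' n is 0 then 1 else
  if C (code_pair c n) is 0 then 1 else 0.
have testT c : exists n, test c n == 0.
  have := V'E c; rewrite /test; case: (boolP (V c)) => [/VP[x <-] -> /=|_ ->]; last by exists 0.
  have [y xy] := checkT x; exists (pickle y).
  have Wy : W (pickle y) by apply/WP; exists y.
  by have := W'E (pickle y); rewrite Wy => -> /=; rewrite -pickle_pair CE /= xy.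
pose F c := ex_minn (testT c).
have RF: env_recursive (fun e => F (nth 0 e 0)).
  apply: (@env_recursive_min (fun e => test (nth 0 e 1) (nth 0 e 0))) => [|e|e n].
  - apply: env_recursive_if; [|exact: env_recursive_const|].
      exact: env_recursive1 (env_recursive_var 1).
    apply: env_recursive_if; [|exact: env_recursive_const|].
      exact: env_recursive1 (env_recursive_var 0).
    apply: env_recursive_if; [|exact: env_recursive_const..].
    apply: env_recursive1 RC _.
    by apply: env_recursive_code_pair; apply: env_recursive_var.
  - by rewrite /= /F; case: ex_minnP => m /eqP.
  rewrite /= /F; case: ex_minnP => m _ m_min; apply: contraTneq => /eqP/m_min.
  by rewrite -leqNgt.
have FP x : exists y, pickle y = F (pickle x) /\ check x y.
  rewrite /F; case: ex_minnP => n; rewrite /test.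
  have Vx : V (pickle x) by apply/VP; exists x.
  have := V'E (pickle x); rewrite Vx => -> /=; have := W'E n.
  case: (boolP (W n)) => [/WP[y <-] -> /=|_ -> //].
  by rewrite -pickle_pair CE /=; case E: (check x y) => // _ _; exists y.
have FP' x : exists y, (pickle y == F (pickle x)) && check x y.
  by have [y [yF xy]] := FP x; exists y; rewrite yF eqxx.
exists (fun x => xchoose (FP' x)) => [|x].
  apply/computableP; exists F => // x.
  by have /andP[/eqP] := xchooseP (FP' x).
by have /andP[] := xchooseP (FP' x).
Qed.

(** * Normal forms *)

Section NormalForms.

Import GroupScope.

Variables (D : finGroupType) (C : {group D}) (io : bool -> D -> D).
Hypothesis ioM : forall b, {morph io b : x y / x * y}.
Hypothesis io_inj : forall b, {in C &, injective (io b)}.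

Definition label := (bool * D)%type.

Definition edge_group b : {set D} := io b @: C.

Lemma io1 b : io b 1 = 1.
Proof. by apply: (mulgI (io b 1)); rewrite -ioM !mulg1. Qed.

Lemma ioV b x : io b x^-1 = (io b x)^-1.
Proof. by apply: (mulgI (io b x)); rewrite -ioM !mulgV io1. Qed.

Lemma edge_group_set b : group_set (edge_group b).
Proof.
apply/group_setP; split=> [|_ _ /imsetP[x Cx ->] /imsetP[y Cy ->]].
  by apply/imsetP; exists 1; rewrite ?group1 ?io1.
by rewrite -ioM imset_f // groupM.
Qed.
Canonical edge_group_group b := Group (edge_group_set b).

Definition coset_rep b x : D := repr (x *: edge_group b).

Definition edge_pre b x : D := odflt 1 [pick c in C | io b c == x].

Lemma edge_preP b x : x \in edge_group b ->
  edge_pre b x \in C /\ io b (edge_pre b x) = x.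
Proof.
case/imsetP=> c Cc ->; rewrite /edge_pre; case: pickP => [d /andP[Cd /eqP //]|].
by move/(_ c); rewrite Cc eqxx.
Qed.

Lemma edge_preK b c : c \in C -> edge_pre b (io b c) = c.
Proof.
move=> Cc; have [Cp /(io_inj Cp Cc)->//] := @edge_preP b (io b c) (imset_f _ Cc).
Qed.

(** [repr] picks 1 from any set containing it, so the trivial coset contributes no syllable. *)
Lemma coset_rep_edge b x : x \in edge_group b -> coset_rep b x = 1.
Proof.
by move=> Ax; rewrite /coset_rep lcoset_id // /repr group1.
Qed.

Lemma coset_repP b x : (coset_rep b x)^-1 * x \in edge_group b.
Proof.
rewrite -groupV invMg invgK -mem_lcoset.
exact: mem_repr (lcoset_refl _ _).
Qed.

Lemma coset_repM b x a : a \in edge_group b -> coset_rep b (x * a) = coset_rep b x.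
Proof. by move=> Aa; rewrite /coset_rep lcosetM lcoset_id. Qed.

Lemma coset_rep_id b x : coset_rep b (coset_rep b x) = coset_rep b x.
Proof.
have {2}-> : x = coset_rep b x * ((coset_rep b x)^-1 * x) by rewrite mulKVg.
by rewrite coset_repM ?coset_repP.
Qed.

(* The state (l, d) stands for the normal form r_n ... r_1 d whose coset
   representatives r_i are listed in l with the last one first. *)
Definition state := (seq label * D)%type.

(** Together with [fold_state] this is a bijection: a valid state amounts to a reduced list not
    ending in colour [b], paired with an arbitrary element of [D]. In that form multiplication in
    the factor only touches the second component. *)
Definition unfold_state b (s : state) : state :=
  if s.1 is e :: l then
    if e.1 == b then (l, e.2 * io b s.2) else (s.1, io b s.2)
  else (s.1, io b s.2).

Definition fold_state b (s : state) : state :=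
  let r := coset_rep b s.2 in
  let d := edge_pre b (r^-1 * s.2) in
  if r == 1 then (s.1, d) else ((b, r) :: s.1, d).

Definition fresh b (l : seq label) := if l is e :: _ then e.1 != b else true.

Fixpoint reduced (l : seq label) :=
  if l is e :: l' then
    [&& e.2 != 1, coset_rep e.1 e.2 == e.2, fresh e.1 l' & reduced l']
  else true.

Definition valid (s : state) := (s.2 \in C) && reduced s.1.

Lemma unfold_fresh b s : valid s ->
  fresh b (unfold_state b s).1 && reduced (unfold_state b s).1.
Proof.
case: s => -[|[b' r] l] d //= /andP[_ /=] /and4P[r1 rr fr red].
rewrite /unfold_state /=; case: (eqVneq b' b) => [<-|bb'] /=; first by rewrite fr.
by rewrite bb' r1 rr fr.
Qed.

Lemma fold_valid b s : fresh b s.1 -> reduced s.1 -> valid (fold_state b s).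
Proof.
move=> fr red; rewrite /valid /fold_state.
have [Cp _] := edge_preP (coset_repP b s.2).
by case: eqVneq => r1 /=; rewrite Cp ?red // r1 coset_rep_id eqxx fr.
Qed.

Lemma unfoldK b s : valid s -> fold_state b (unfold_state b s) = s.
Proof.
case: s => l d /andP[/= Cd red].
have Fd : fold_state b (l, io b d) = (l, d).
  by rewrite /fold_state /= coset_rep_edge ?imset_f // eqxx invg1 mul1g edge_preK.
case: l red Fd => [|[b' r] l] red Fd; first exact: Fd.
rewrite /unfold_state /=; case: (eqVneq b' b) => //= eb.
move: red => /=/and4P[r1 /eqP rr _ _]; rewrite eb in rr *.
rewrite /fold_state /= coset_repM ?imset_f // rr (negPf r1) mulKg edge_preK //.
Qed.

Lemma foldK b s : fresh b s.1 -> unfold_state b (fold_state b s) = s.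
Proof.
case: s => l x /= fr; rewrite /fold_state /=.
have [Cp pE] := edge_preP (coset_repP b x); case: eqVneq => r1.
  move: pE; rewrite r1 invg1 mul1g => pE; rewrite /unfold_state /=.
  by case: l fr => [|e l] /=; [|move=> /negPf->]; rewrite pE.
by rewrite /unfold_state /= eqxx pE mulKVg.
Qed.

(** Right multiplication by [e.2], transported through the bijection above. That each factor acts
    then follows from [unfoldK] and [foldK], without a case analysis on cancellation. *)
Definition step (s : state) (e : label) : state :=
  let t := unfold_state e.1 s in fold_state e.1 (t.1, t.2 * e.2).

Definition run (s : state) (p : seq label) := foldl step s p.

Definition start : state := ([::], 1).

Lemma valid_start : valid start.
Proof. by rewrite /valid group1. Qed.

Lemma step_valid s e : valid s -> valid (step s e).
Proof. by move=> /(@unfold_fresh e.1)/andP[fr red]; apply: fold_valid. Qed.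

Lemma run_valid s p : valid s -> valid (run s p).
Proof. by elim: p s => //= e p IHp s /(step_valid e)/IHp. Qed.

Lemma unfold_step s e : valid s -> unfold_state e.1 (step s e) =
  ((unfold_state e.1 s).1, (unfold_state e.1 s).2 * e.2).
Proof. by move=> /(@unfold_fresh e.1)/andP[fr _]; apply: foldK. Qed.

Lemma step1 b s : valid s -> step s (b, 1) = s.
Proof. by move=> vs; rewrite /step /= mulg1 -surjective_pairing unfoldK. Qed.

Lemma stepM b x y s : valid s -> step (step s (b, x)) (b, y) = step s (b, x * y).
Proof.
by move=> vs; rewrite {1}/step (unfold_step (b, x)) //= -mulgA.
Qed.

(** The result is independent of [b]: the two factors act alike on [C], so their actions combine
    into one of the amalgam. *)
Lemma step_edge b d s : d \in C -> valid s -> step s (b, io b d) = (s.1, s.2 * d).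
Proof.
move=> Cd vs; rewrite /step /=.
have vs' : valid (s.1, s.2 * d) by case/andP: vs => Cs red; rewrite /valid /= groupM.
rewrite -[RHS](unfoldK b vs'); congr fold_state.
rewrite /unfold_state /=; case: s.1 => [|e l] /=; rewrite ?ioM //.
by case: ifP => _; rewrite ?mulgA.
Qed.

Lemma run_cat s p q : run s (p ++ q) = run (run s p) q.
Proof. exact: foldl_cat. Qed.

End NormalForms.

(** * Graphs read by normal forms *)

#[global] Hint Resolve pres_eq_refl : core.

Section Presented.

Variables (X : eqType) (R : seq (word X)).

#[global] Instance pres_eq_equiv : Equivalence (pres_eq R).
Proof.
split; [exact: pres_eq_refl|exact: pres_eq_sym|exact: pres_eq_trans].
Qed.

#[global] Instance pres_eq_cat_proper :
  Proper (pres_eq R ==> pres_eq R ==> pres_eq R) (@cat (X * bool)).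
Proof. by move=> u u' uu' v v' vv'; apply: pres_eq_cat. Qed.

Lemma word_inv_cat (u v : word X) : word_inv (u ++ v) = word_inv v ++ word_inv u.
Proof. by rewrite /word_inv map_cat rev_cat. Qed.

Lemma word_invK : involutive (@word_inv X).
Proof.
move=> w; rewrite /word_inv map_rev revK -map_comp -[RHS]map_id.
by apply: eq_map => -[x b] /=; rewrite negbK.
Qed.

Lemma pres_eq_mulV w : pres_eq R (w ++ word_inv w) [::].
Proof.
elim: w => [|[x b] w IHw]; first exact: pres_eq_refl.
rewrite -cat1s word_inv_cat -catA (catA w) IHw.
exact: pres_eq_cancel.
Qed.

Lemma pres_eq_Vmul w : pres_eq R (word_inv w ++ w) [::].
Proof. by rewrite -{2}[w]word_invK pres_eq_mulV. Qed.

#[global] Instance word_inv_proper : Proper (pres_eq R ==> pres_eq R) (@word_inv X).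
Proof.
move=> u v uv; rewrite -[word_inv u]cats0 -(pres_eq_mulV v) -{1}uv catA.
by rewrite pres_eq_Vmul.
Qed.

Lemma pres_eq_invr u v : pres_eq R (u ++ v) [::] -> pres_eq R v (word_inv u).
Proof. by move=> uv; rewrite -[v]cat0s -(pres_eq_Vmul u) -catA uv cats0. Qed.

End Presented.

Lemma neq_negb (b b' : bool) : b' != b -> b' = ~~ b.
Proof. by case: b b' => [] []. Qed.

Section GraphPaths.

Import GroupScope.

Variables (D : finGroupType) (C : {group D}) (io : bool -> D -> D).
Hypothesis ioM : forall b, {morph io b : x y / x * y}.

Local Notation label := (label D).
Local Notation unfold_state := (unfold_state io).
Local Notation step := (step C io).
Local Notation run := (run C io).
Local Notation start := (start D).
Local Notation valid := (valid C io).

Variables (Z : eqType) (R : seq (word Z)).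
Local Notation "u =R v" := (pres_eq R u v) (at level 70).

Variable Ed : nat -> label -> nat -> word Z -> Prop.
Hypothesis Ed_mul : forall v b x u z y w z',
  Ed v (b, x) u z -> Ed u (b, y) w z' ->
  exists2 z'', Ed v (b, x * y) w z'' & z ++ z' =R z''.
Hypothesis Ed_inv : forall v b x u z,
  Ed v (b, x) u z -> exists2 z', Ed u (b, x^-1) v z' & z' =R word_inv z.
Hypothesis Ed_unit : forall v b u z, Ed v (b, 1) u z -> u = v /\ z =R [::].
Hypothesis Ed_edge : forall v b x u z y w z' c,
  Ed v (b, x) u z -> Ed v (~~ b, y) w z' -> c \in C ->
  exists t z1 z2, [/\ Ed v (b, io b c) t z1, Ed v (~~ b, io (~~ b) c) t z2 & z1 =R z2].

(** The inverse of one edge followed by the other has label 1, and unit edges are loops with trivial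
    words. *)
Lemma Ed_det v b x u z u' z' : Ed v (b, x) u z -> Ed v (b, x) u' z' -> u = u' /\ z =R z'.
Proof.
move=> e e'; have [zi ei Ei] := Ed_inv e.
have [y] := Ed_mul ei e'; rewrite mulVg => /Ed_unit[-> y1] Ey; split=> //.
have : zi ++ z' =R [::] by rewrite Ey.
by move/pres_eq_invr->; rewrite Ei word_invK.
Qed.

(** [Ed_edge] gives edges leaving a two-coloured vertex. Here that vertex is the target, so it is
    applied to the inverse of [c] and the result is inverted; determinism identifies the other
    end. *)
Lemma Ed_edge_src v b c u z y w z' : c \in C ->
  Ed v (b, io b c) u z -> Ed u (~~ b, y) w z' ->
  exists2 z'', Ed v (~~ b, io (~~ b) c) u z'' & z'' =R z.
Proof.
move=> Cc e e'; have [zi ei Ei] := Ed_inv e.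
have Cc' : c^-1 \in C by rewrite groupV.
have [t [z1 [z2 [e1 e2 E12]]]] := Ed_edge ei e' Cc'.
rewrite -ioV // in ei; have [vt E1] := Ed_det ei e1; rewrite -{}vt in e1 e2.
have [z3] := Ed_inv e2; rewrite ioV // invgK => e3 E3; exists z3 => //.
by rewrite E3 -E12 -E1 Ei word_invK.
Qed.

Fixpoint gpath v p w z : Prop :=
  if p is e :: p' then
    exists u z1 z2, [/\ Ed v e u z1, gpath u p' w z2 & z = z1 ++ z2]
  else w = v /\ z = [::].

Lemma gpath_cat v p u z q w z' :
  gpath v p u z -> gpath u q w z' -> gpath v (p ++ q) w (z ++ z').
Proof.
elim: p v z => [|e p IHp] v z /=; first by case=> -> ->.
case=> t [z1 [z2 [vt tu ->]]] uw; exists t, z1, (z2 ++ z').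
by split; rewrite ?catA //; apply: IHp.
Qed.

Lemma gpath1 v e u z : Ed v e u z -> gpath v [:: e] u z.
Proof. by move=> vu; exists u, z, [::]; rewrite cats0. Qed.

Lemma gpath_rcons v p e w z : gpath v (rcons p e) w z ->
  exists u z1 z2, [/\ gpath v p u z1, Ed u e w z2 & z = z1 ++ z2].
Proof.
elim: p v z => [|e' p IHp] v z /=.
  by case=> u [z1 [z2 [vu [-> ->] ->]]]; exists v, [::], z1; rewrite cats0.
case=> t [z1 [z2 [vt /IHp[u [z3 [z4 [tu uw ->]]]] ->]]].
by exists u, (z1 ++ z3), z4; split; rewrite ?catA //; exists t, z1, z3.
Qed.

Lemma rcons_gpath v p e u w z1 z2 : gpath v p u z1 -> Ed u e w z2 ->
  gpath v (rcons p e) w (z1 ++ z2).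
Proof. by move=> vu /gpath1; rewrite -cats1; apply: gpath_cat. Qed.

Arguments gpath : simpl never.

(* The normal form s, spelled with its last syllable in the factor b, is read
   along a path equivalent to z. *)
Definition spelled b (s : state D) v u z :=
  exists2 z', gpath v (rcons (rev (unfold_state b s).1) (b, (unfold_state b s).2)) u z'
    & z' =R z.

Lemma spelled_step b s v u z x w z' : valid s ->
  spelled b s v u z -> Ed u (b, x) w z' -> spelled b (step s (b, x)) v w (z ++ z').
Proof.
move=> vs [z0 /gpath_rcons[t [z1 [z2 [vt tu ->]]]] E0] uw.
rewrite /spelled (unfold_step ioM (b, x)) //=.
have [z3 tw E3] := Ed_mul tu uw; exists (z1 ++ z3); first exact: rcons_gpath tw.
by rewrite -E3 catA E0.
Qed.

(** The next edge has the other colour, so [u] meets both colours and the final element of [C] can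
    be moved to the other factor. *)
Lemma spelled_switch b s v u z y w z' : valid s ->
  spelled b s v u z -> Ed u (~~ b, y) w z' -> spelled (~~ b) s v u z.
Proof.
case: s => l d /andP[/= Cd red] [z0 /gpath_rcons[t [z1 [z2 [vt tu ->]]]] E0] uw.
case: l red vt tu => [|[b' r] l] red.
  rewrite /spelled /unfold_state /= => vt tu.
  have [z3 tu' E3] := Ed_edge_src Cd tu uw.
  by exists (z1 ++ z3); [exact: (rcons_gpath vt tu')|rewrite -E0 E3].
rewrite /spelled /unfold_state /=.
case: (eqVneq b' b) => [-> {b' red}|bb'] vt tu.
  have -> /= : (b == ~~ b) = false by case: (b).
  have Cd' : d^-1 \in C by rewrite groupV.
  have [zi ut Ei] := Ed_inv tu.
  have [x [z3 [z4 [ux ux' E34]]]] := Ed_edge ut uw Cd'.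
  have [z5] := Ed_mul tu ux; rewrite ioV // mulgK => tx E5.
  have [z6] := Ed_inv ux'; rewrite ioV // invgK => xu E6.
  exists ((z1 ++ z5) ++ z6).
    by rewrite rev_cons; apply: rcons_gpath xu; apply: rcons_gpath tx.
  by rewrite -E0 -E5 E6 E34 -!catA pres_eq_mulV cats0.
(* The last syllable lies in the other factor, so the recoloured edge of [d] merges with it. *)
have eb := neq_negb bb'.
rewrite eb eqxx /= in vt *.
have [z3 tu' E3] := Ed_edge_src Cd tu uw.
rewrite rev_cons in vt; have [x [z4 [z5 [vx xt z1E]]]] := gpath_rcons vt.
have [z6 xu E6] := Ed_mul xt tu'; exists (z4 ++ z6); first exact: rcons_gpath xu.
by rewrite -E6 -E0 E3 catA z1E.
Qed.

Lemma spelled_start b v x u z : Ed v (b, x) u z -> spelled b start v v [::].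
Proof.
(* The unit edge at [v] arises by going along the given edge and back. *)
move=> vu; have [z1 uv _] := Ed_inv vu; have [z2 vv _] := Ed_mul vu uv.
rewrite mulgV in vv; have [_ E2] := Ed_unit vv.
exists z2 => //; rewrite /unfold_state /= io1 //; exact: gpath1.
Qed.

(** A spelling always ends in an edge, even for the trivial normal form, so the empty path is kept
    apart; otherwise [b] is the colour of the last edge. *)
Lemma spelled_run v p u z : gpath v p u z -> p = [::] \/
  exists b, spelled b (run start p) v u z.
Proof.
elim/last_ind: p u z => [|p [b x] IHp] u z; first by left.
case/gpath_rcons=> t [z1 [z2 [vt tu ->]]]; right; exists b.
have vs : valid (run start p) by apply: run_valid => //; apply: valid_start.
rewrite /run foldl_rcons -/(run start p); apply: (spelled_step vs _ tu).
have [p0|[b' sp]] := IHp _ _ vt.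
  by move: vt; rewrite p0 /= => -[tv ->]; rewrite -tv; apply: spelled_start tu.
case: (eqVneq b' b) => [<- //|bb'].
have eb : b = ~~ b' by apply: neq_negb; rewrite eq_sym.
by rewrite eb in tu *; apply: spelled_switch sp tu.
Qed.

Lemma gpath_start v p u z : gpath v p u z -> run start p = start -> z =R [::].
Proof.
move=> vu ps; have [p0|[b]] := spelled_run vu.
  by move: vu; rewrite p0 => -[_ ->].
(* The trivial normal form is spelled by a single edge with label 1, whose word is trivial by
   [Ed_unit]. *)
rewrite ps => -[z' /=]; rewrite /unfold_state /= io1 // => -[t [z1 [z2]]].
by case=> /Ed_unit[_ z10] [_ ->] ->; rewrite cats0 z10 => <-.
Qed.

Lemma gpath_rev v p u z : gpath v p u z ->
  exists2 z', gpath u (rev [seq (e.1, e.2^-1) | e <- p]) v z' & z' =R word_inv z.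
Proof.
elim: p v z => [|[b x] p IHp] v z /=; first by case=> -> ->; exists [::].
case=> t [z1 [z2 [/Ed_inv[z3 tv E3] /IHp[z4 ut E4] ->]]].
exists (z4 ++ z3); first by rewrite rev_cons; apply: rcons_gpath tv.
by rewrite word_inv_cat E3 E4.
Qed.

End GraphPaths.

(** * Values of words and paths in a group *)

Section WordVal.

Import GroupScope.

Variables (G : groupType) (X : Type) (gen : X -> G).

Lemma word_val_nil : word_val gen [::] = 1.
Proof. exact: big_nil. Qed.

Lemma word_val_cons l w :
  word_val gen (l :: w) = (if l.2 then (gen l.1)^-1 else gen l.1) * word_val gen w.
Proof. exact: big_cons. Qed.

Lemma word_val_cat u v : word_val gen (u ++ v) = word_val gen u * word_val gen v.
Proof. exact: big_cat. Qed.

Lemma word_val_inv w : word_val gen (word_inv w) = (word_val gen w)^-1.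
Proof.
elim: w => [|[x b] w IHw]; first by rewrite /word_inv /= word_val_nil invg1.
rewrite /word_inv map_cons rev_cons -cats1 -/(word_inv w) word_val_cat IHw.
by rewrite !word_val_cons word_val_nil mulg1 invMg; case: b => /=; rewrite ?invgK.
Qed.

Lemma word_val_map (Z : Type) (f : Z -> X) w :
  word_val gen (word_map f w) = word_val (gen \o f) w.
Proof. by rewrite /word_val big_map. Qed.

Lemma subgroup_gen_word g :
  subgroup_gen (image_of gen) g <-> exists w, g = word_val gen w.
Proof.
split=> [|[w ->]].
  elim=> {g} [_ [x ->]||g h _ [u ->] _ [v ->]|g _ [u ->]].
  - by exists [:: (x, false)]; rewrite word_val_cons word_val_nil mulg1.
  - by exists [::]; rewrite word_val_nil.
  - by exists (u ++ v); rewrite word_val_cat.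
  - by exists (word_inv u); rewrite word_val_inv.
elim: w => [|[x b] w IHw]; first by rewrite word_val_nil; apply: subgroup_gen_1.
rewrite word_val_cons; apply: subgroup_gen_mul => //.
have xx : subgroup_gen (image_of gen) (gen x) by apply: subgroup_gen_in; exists x.
by case: b => //=; apply: subgroup_gen_inv.
Qed.

End WordVal.

Section PresVal.

Import GroupScope.

Variables (G : groupType) (X : eqType) (gen : X -> G) (R : seq (word X)).
Hypothesis relR : forall r, r \in R -> word_val gen r = 1.

Lemma pres_eq_val u v : pres_eq R u v -> word_val gen u = word_val gen v.
Proof.
elim=> {u v} [//|u v _ -> //|u v w _ -> _ -> //|u u' v v' _ uu' _ vv'|x b|r rR].
- by rewrite !word_val_cat uu' vv'.
- rewrite !word_val_cons word_val_nil mulg1.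
  by case: b; rewrite /= ?mulVg ?mulgV.
by rewrite relR // word_val_nil.
Qed.

End PresVal.

Section Valuation.

Import GroupScope.

Variables (D : finGroupType) (C : {group D}) (io : bool -> D -> D).
Hypothesis ioM : forall b, {morph io b : x y / x * y}.
Variables (G : groupType) (F : bool -> D -> G).
Hypothesis FM : forall b, {morph F b : x y / x * y}.
Hypothesis F_edge : forall c, c \in C -> F false (io false c) = F true (io true c).

Definition path_val (p : seq (label D)) : G := \prod_(e <- p) F e.1 e.2.

Lemma path_val_nil : path_val [::] = 1.
Proof. exact: big_nil. Qed.

Lemma path_val_cons e p : path_val (e :: p) = F e.1 e.2 * path_val p.
Proof. exact: big_cons. Qed.

Lemma path_val_cat p q : path_val (p ++ q) = path_val p * path_val q.
Proof. exact: big_cat. Qed.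

Lemma factor_val1 b : F b 1 = 1.
Proof. by apply: (mulgI (F b 1)); rewrite -FM !mulg1. Qed.

Lemma factor_valV b x : F b x^-1 = (F b x)^-1.
Proof. by apply: (mulgI (F b x)); rewrite -FM !mulgV factor_val1. Qed.

Lemma path_val_rev p : path_val (rev [seq (e.1, e.2^-1) | e <- p]) = (path_val p)^-1.
Proof.
elim: p => [|e p IHp] /=; first by rewrite path_val_nil invg1.
rewrite rev_cons -cats1 path_val_cat IHp !path_val_cons path_val_nil mulg1 /=.
by rewrite factor_valV invMg.
Qed.

(** The part in [C] is evaluated in the factor [true]; [F_edge_color] moves it to the factor in
    which a step takes place. *)
Definition state_val (s : state D) : G := path_val (rev s.1) * F true (io true s.2).

Lemma F_edge_color b b' c : c \in C -> F b (io b c) = F b' (io b' c).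
Proof. by case: b b' => [] [] // /F_edge. Qed.

Lemma unfold_state_val b s : s.2 \in C ->
  state_val s = path_val (rev (unfold_state io b s).1) * F b (unfold_state io b s).2.
Proof.
case: s => l d /= Cd; rewrite /state_val (F_edge_color true b Cd) /=.
case: l => [|[b' r] l] //; rewrite /unfold_state /=.
case: eqP => //= ->; rewrite rev_cons -cats1 path_val_cat path_val_cons path_val_nil.
by rewrite mulg1 FM mulgA.
Qed.

Lemma step_val s e : valid C io s -> state_val (step C io s e) = state_val s * F e.1 e.2.
Proof.
move=> vs; have /andP[Cs' _] := step_valid ioM e vs.
have /andP[Cs _] := vs.
rewrite (unfold_state_val e.1 Cs') (unfold_state_val e.1 Cs) unfold_step //=.
by rewrite FM mulgA.
Qed.

Lemma run_val s p : valid C io s -> state_val (run C io s p) = state_val s * path_val p.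
Proof.
elim: p s => [|e p IHp] s vs; first by rewrite path_val_nil mulg1.
by rewrite /= IHp ?step_valid // step_val // path_val_cons mulgA.
Qed.

Lemma run_start_val p : run C io (start D) p = start D -> path_val p = 1.
Proof.
move=> ps; have := run_val p (valid_start C io); rewrite ps.
by rewrite -[LHS]mulg1 => /mulgI.
Qed.

End Valuation.

(** * The amalgam *)

Lemma word_map_inv (X Z : Type) (f : X -> Z) w :
  word_map f (word_inv w) = word_inv (word_map f w).
Proof. by rewrite /word_map /word_inv map_rev -!map_comp. Qed.

Lemma pres_eq_map (X Z : eqType) (f : X -> Z) (R : seq (word X)) (S : seq (word Z)) u v :
  (forall r, r \in R -> pres_eq S (word_map f r) [::]) ->
  pres_eq R u v -> pres_eq S (word_map f u) (word_map f v).
Proof.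
move=> RS; elim=> {u v} [u|u v _|u v w _ uv _|u u' v v' _ uu' _ vv'|x b|r /RS //] //.
- exact: pres_eq_sym.
- exact: pres_eq_trans.
- by rewrite /word_map !map_cat; apply: pres_eq_cat.
- exact: pres_eq_cancel.
Qed.

Section Multiplicative.

Import GroupScope.

Variables (H K : groupType) (f : {multiplicative H -> K}).

Lemma multiplicative1 : f 1 = 1.
Proof. by apply: (mulgI (f 1)); rewrite -gmulfM !mulg1. Qed.

Lemma multiplicativeV x : f x^-1 = (f x)^-1.
Proof. by apply: (mulgI (f x)); rewrite -gmulfM !mulgV multiplicative1. Qed.

End Multiplicative.

Section Amalgam.

Import GroupScope.

Variables (X1 X2 Y : finType) (R1 : seq (word X1)) (R2 : seq (word X2))
    (G1 G2 : finGroupType) (gen1 : X1 -> G1) (gen2 : X2 -> G2)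
    (A : groupType) (genA : Y -> A)
    (phi1 : {multiplicative A -> G1}) (phi2 : {multiplicative A -> G2})
    (u1 : Y -> word X1) (u2 : Y -> word X2)
    (G : groupType) (gen : (X1 + X2)%type -> G).
Hypothesis presG1 : presents (@whole G1) gen1 R1.
Hypothesis presG2 : presents (@whole G2) gen2 R2.
Hypothesis genAY : forall a : A, subgroup_gen (image_of genA) a.
Hypotheses (phi1_inj : injective phi1) (phi2_inj : injective phi2).
Hypothesis u1E : forall y, word_val gen1 (u1 y) = phi1 (genA y).
Hypothesis u2E : forall y, word_val gen2 (u2 y) = phi2 (genA y).
Hypothesis presG : presents (@whole G) gen (amalgam_rels R1 R2 u1 u2).

Local Notation D := (G1 * G2)%type.

(* Both factors are embedded in G1 * G2, and an element a of the amalgamated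
   group is represented by the pair (phi1 a, phi2 a). *)
Definition factor (b : bool) (d : D) : D := if b then (1, d.2) else (d.1, 1).

(** [A] is given abstractly, so membership is classical; as a subset of the finite group [D] it
    still enters the algorithm as a fixed table. *)
Definition amalgamated : {set D} := [set d | `[< exists a, d = (phi1 a, phi2 a) >]].

Lemma factorM b : {morph factor b : x y / x * y}.
Proof. by case: b => -[x1 x2] [y1 y2]; congr pair => /=; rewrite mulg1. Qed.

Lemma amalgamated_group_set : group_set amalgamated.
Proof.
apply/group_setP; split=> [|d d']; rewrite !inE.
  by apply/asboolP; exists 1; rewrite !multiplicative1.
move=> /asboolP[a ->] /asboolP[b ->]; apply/asboolP; exists (a * b).
by rewrite !gmulfM.
Qed.
Canonical amalgamated_group := Group amalgamated_group_set.

Lemma factor_inj b : {in amalgamated_group &, injective (factor b)}.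
Proof.
move=> d d'; rewrite !inE => /asboolP[a ->] /asboolP[a' ->].
by case: b => -[]; [move/phi2_inj->|move/phi1_inj->].
Qed.

Lemma word_of1 g : exists w, g = word_val gen1 w.
Proof. exact/subgroup_gen_word/(presG1.1 g). Qed.

Lemma word_of2 g : exists w, g = word_val gen2 w.
Proof. exact/subgroup_gen_word/(presG2.1 g). Qed.

(** Evaluating a chosen word defines the map from each factor to G. The relators of the factor hold
    in G, so the value does not depend on the choice. *)
Definition label_word (e : label D) : word (X1 + X2)%type :=
  if e.1 then word_map inr (projT1 (cid (word_of2 e.2.2)))
  else word_map inl (projT1 (cid (word_of1 e.2.1))).

Definition val_factor b d : G := word_val gen (label_word (b, d)).

Lemma word_val_eq (Z : eqType) (H : groupType) (gH : Z -> H) (S : seq (word Z)) u v :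
  presents (@whole H) gH S -> word_val gH u = word_val gH v <-> pres_eq S u v.
Proof.
case=> _ pS; split=> [uv|]; last first.
  apply: pres_eq_val => r rS; apply/pS; exact: pres_eq_rel.
have : pres_eq S (u ++ word_inv v) [::].
  by apply/pS; rewrite word_val_cat word_val_inv uv mulgV.
by move/pres_eq_invr/(@word_inv_proper _ _); rewrite !word_invK => ->.
Qed.

Lemma rel_inl r : r \in R1 -> pres_eq (amalgam_rels R1 R2 u1 u2) (word_map inl r) [::].
Proof. by move=> Rr; apply: pres_eq_rel; rewrite !mem_cat map_f. Qed.

Lemma rel_inr r : r \in R2 -> pres_eq (amalgam_rels R1 R2 u1 u2) (word_map inr r) [::].
Proof. by move=> Rr; apply: pres_eq_rel; rewrite !mem_cat map_f ?orbT. Qed.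

Lemma word_val_inl w :
  word_val gen (word_map inl w) = val_factor false (word_val gen1 w, 1).
Proof.
apply/(word_val_eq _ _ presG)/(pres_eq_map rel_inl)/(word_val_eq _ _ presG1).
by rewrite /=; case: cid.
Qed.

Lemma word_val_inr w :
  word_val gen (word_map inr w) = val_factor true (1, word_val gen2 w).
Proof.
apply/(word_val_eq _ _ presG)/(pres_eq_map rel_inr)/(word_val_eq _ _ presG2).
by rewrite /=; case: cid.
Qed.

Lemma val_factorE b d : val_factor b (factor b d) = val_factor b d.
Proof. by case: b. Qed.

Lemma val_factorM b : {morph val_factor b : x y / x * y}.
Proof.
move=> [x1 x2] [y1 y2]; case: b.
  rewrite -[LHS]val_factorE -[val_factor _ (x1, _)]val_factorE.
  rewrite -[val_factor _ (y1, _)]val_factorE /=.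
  have [u ->] := word_of2 x2; have [v ->] := word_of2 y2.
  by rewrite -word_val_cat -!word_val_inr /word_map map_cat word_val_cat.
rewrite -[LHS]val_factorE -[val_factor _ (x1, _)]val_factorE.
rewrite -[val_factor _ (y1, _)]val_factorE /=.
have [u ->] := word_of1 x1; have [v ->] := word_of1 y1.
by rewrite -word_val_cat -!word_val_inl /word_map map_cat word_val_cat.
Qed.

(** By induction on the expression of [a] in the generators [genA y]: the amalgamation relators
    settle a generator, multiplicativity the rest. *)
Lemma val_factor_edge c : c \in amalgamated_group ->
  val_factor false (factor false c) = val_factor true (factor true c).
Proof.
rewrite inE => /asboolP[a ->]; rewrite /factor /=.
elim: (genAY a) => {a} [_ [y ->]||a b _ IHa _ IHb|a _ IHa].
- rewrite -u1E -u2E -word_val_inl -word_val_inr.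
  apply: (mulIg (word_val gen (word_map inr (u2 y)))^-1).
  rewrite mulgV -word_val_inv -word_val_cat; apply/presG.2/pres_eq_rel.
  by rewrite !mem_cat (map_f (fun y => word_map inl (u1 y) ++ _)) ?orbT ?mem_enum.
- by rewrite !multiplicative1 !factor_val1 //; apply: val_factorM.
- have -> : (phi1 (a * b), 1 : G2) = (phi1 a, 1) * (phi1 b, 1) :> D.
    by rewrite gmulfM; congr pair; rewrite /= mulg1.
  have -> : (1 : G1, phi2 (a * b)) = (1, phi2 a) * (1, phi2 b) :> D.
    by rewrite gmulfM; congr pair; rewrite /= mulg1.
  by rewrite !val_factorM IHa IHb.
- have -> : (phi1 a^-1, 1 : G2) = (phi1 a, 1)^-1 :> D.
    by rewrite multiplicativeV; congr pair; rewrite /= invg1.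
  have -> : (1 : G1, phi2 a^-1) = (1, phi2 a)^-1 :> D.
    by rewrite multiplicativeV; congr pair; rewrite /= invg1.
  by rewrite !factor_valV ?IHa //; apply: val_factorM.
Qed.

Definition letter_label (l : (X1 + X2) * bool) : label D :=
  match l.1 with
  | inl x => (false, (if l.2 then (gen1 x)^-1 else gen1 x, 1))
  | inr x => (true, (1, if l.2 then (gen2 x)^-1 else gen2 x))
  end.

Definition label_in_factor (e : label D) := factor e.1 e.2 == e.2.

Local Notation path_val := (path_val val_factor).
Local Notation run := (run amalgamated_group factor).
Local Notation step := (step amalgamated_group factor).
Local Notation valid := (valid amalgamated_group factor).

Lemma letter_label_in_factor l : label_in_factor (letter_label l).
Proof. by case: l => -[x|x] b; apply/eqP. Qed.

Lemma letter_path_val w : path_val [seq letter_label l | l <- w] = word_val gen w.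
Proof.
elim: w => [|[x b] w IHw]; first by rewrite path_val_nil word_val_nil.
rewrite path_val_cons word_val_cons IHw; congr (_ * _).
have -> : (if b then (gen x)^-1 else gen x) = word_val gen [:: (x, b)].
  by rewrite word_val_cons word_val_nil mulg1.
case: x => x.
  have := word_val_inl [:: (x, b)]; rewrite word_val_cons word_val_nil mulg1.
  by move=> ->.
have := word_val_inr [:: (x, b)]; rewrite word_val_cons word_val_nil mulg1.
by move=> ->.
Qed.

Lemma run_inl w s : valid s ->
  run s [seq letter_label l | l <- word_map inl w] = step s (false, (word_val gen1 w, 1)).
Proof.
elim: w s => [|[x b] w IHw] s vs; first by rewrite word_val_nil (step1 factorM factor_inj).
rewrite /= IHw; last by apply: step_valid vs; apply: factorM.
rewrite word_val_cons (stepM factorM) //.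
by congr (step s (_, (_, _))); rewrite /= mulg1.
Qed.

Lemma run_inr w s : valid s ->
  run s [seq letter_label l | l <- word_map inr w] = step s (true, (1, word_val gen2 w)).
Proof.
elim: w s => [|[x b] w IHw] s vs; first by rewrite word_val_nil (step1 factorM factor_inj).
rewrite /= IHw; last by apply: step_valid vs; apply: factorM.
rewrite word_val_cons (stepM factorM) //.
by congr (step s (_, (_, _))); rewrite /= mulg1.
Qed.

Lemma run_letters_cat s u v : run s [seq letter_label l | l <- u ++ v] =
  run (run s [seq letter_label l | l <- u]) [seq letter_label l | l <- v].
Proof. by rewrite map_cat run_cat. Qed.

(** Each defining relator fixes every valid state, so the action of letters descends to G. *)
Lemma run_pres_eq u v s : pres_eq (amalgam_rels R1 R2 u1 u2) u v -> valid s ->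
  run s [seq letter_label l | l <- u] = run s [seq letter_label l | l <- v].
Proof.
move=> uv; elim: uv s => {u v} [//|u v _ IH|u v w _ IHu _ IHv|u u' v v' _ IHu _ IHv|x b|r rR] s vs.
- by rewrite IH.
- by rewrite IHu ?IHv.
- rewrite !run_letters_cat IHu // IHv //.
  by apply: run_valid vs; apply: factorM.
- case: x => x.
    have := @run_inl [:: (x, b); (x, ~~ b)] s vs; rewrite /= => ->.
    rewrite !word_val_cons word_val_nil mulg1 /=.
    by case: b; rewrite /= ?mulVg ?mulgV (step1 factorM factor_inj).
  have := @run_inr [:: (x, b); (x, ~~ b)] s vs; rewrite /= => ->.
  rewrite !word_val_cons word_val_nil mulg1 /=.
  by case: b; rewrite /= ?mulVg ?mulgV (step1 factorM factor_inj).
move: rR; rewrite !mem_cat => /or3P[/mapP[r' R1r ->]|/mapP[r' R2r ->]|/mapP[y _ ->]].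
- rewrite run_inl //; have /presG1.2-> : pres_eq R1 r' [::] by apply: pres_eq_rel.
  by rewrite (step1 factorM factor_inj).
- rewrite run_inr //; have /presG2.2-> : pres_eq R2 r' [::] by apply: pres_eq_rel.
  by rewrite (step1 factorM factor_inj).
rewrite run_letters_cat run_inl // -word_map_inv run_inr; last first.
  by apply: step_valid vs; apply: factorM.
have Ca : (phi1 (genA y), phi2 (genA y)) \in amalgamated_group.
  by rewrite inE; apply/asboolP; exists (genA y).
rewrite u1E word_val_inv u2E.
(* The images of [genA y] come from one element of [C], so the first step may be taken in the second
   factor, where it cancels. *)
rewrite -[(phi1 _, 1)]/(factor false (phi1 (genA y), phi2 (genA y))).
rewrite (step_edge factorM factor_inj) // -(step_edge factorM factor_inj true) //.
rewrite (stepM factorM) //.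
have -> : factor true (phi1 (genA y), phi2 (genA y)) * (1, (phi2 (genA y))^-1) = 1.
  by congr pair; rewrite /= ?mulg1 ?mulgV.
by rewrite (step1 factorM factor_inj).
Qed.

Definition label_words p := flatten [seq label_word e | e <- p].

Lemma label_words_val p : word_val gen (label_words p) = path_val p.
Proof.
elim: p => [|[b d] p IHp]; first by rewrite path_val_nil word_val_nil.
by rewrite /label_words /= word_val_cat path_val_cons -IHp.
Qed.

Lemma run_label_words p s : all label_in_factor p -> valid s ->
  run s [seq letter_label l | l <- label_words p] = run s p.
Proof.
elim: p s => [//|[b d] p IHp] s /= /andP[/eqP bd ip] vs.
rewrite /label_words /= run_letters_cat -/(label_words p).
rewrite IHp //; last by apply: run_valid vs; apply: factorM.
congr (run _ p); rewrite /label_word /=; case: b bd => /= bd.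
  by rewrite run_inr //; case: cid => /= w <-; rewrite bd.
by rewrite run_inl //; case: cid => /= w <-; rewrite bd.
Qed.

(** A step multiplies the value of the state, so a return to the start forces value 1; a word of
    value 1 is a consequence of the relators, which act trivially. This solves the word problem for
    the checker. *)
Lemma path_val_eq1 p : all label_in_factor p ->
  path_val p = 1 <-> run (start _) p = start _.
Proof.
move=> ip; split=> [|]; last first.
  by apply: run_start_val => //; [apply: factorM|apply: val_factorM|apply: val_factor_edge].
rewrite -label_words_val => /presG.2 /run_pres_eq/(_ (valid_start _ _)).
by rewrite run_label_words // valid_start.
Qed.

End Amalgam.

(** * Certificates *)

Section Restrict.

Variable m : nat.

(** Certificates use letters in [nat], so that their type is independent of the number of
    generators. Deleting the letters from [m] on is a retraction, so a derivation passing through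
    larger letters still restricts. *)
Definition restrict_word (w : word nat) : word 'I_m :=
  pmap (fun l => omap (fun i => (i, l.2)) (insub l.1)) w.

Lemma restrict_wordK : cancel (word_map val) restrict_word.
Proof. by elim=> [//|[i b] w IHw]; rewrite /restrict_word /= valK /= -/(restrict_word _) IHw. Qed.

Lemma restrict_word_id w : all (fun l => l.1 < m) w -> word_map val (restrict_word w) = w.
Proof.
elim: w => [//|[i b] w IHw] /= /andP[im /IHw wE].
by rewrite /restrict_word /= insubT /= -/(restrict_word _) -[in RHS]wE.
Qed.

Lemma pres_eq_restrict (R : seq (word nat)) u v : pres_eq R u v ->
  pres_eq [seq restrict_word r | r <- R] (restrict_word u) (restrict_word v).
Proof.
elim=> {u v} [//|u v _|u v w _ uv _|u u' v v' _ uu' _ vv'|i b|r rR].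
- exact: pres_eq_sym.
- exact: pres_eq_trans.
- by rewrite /restrict_word !pmap_cat; apply: pres_eq_cat.
- rewrite /restrict_word /=; case: insubP => //= j _ _; exact: pres_eq_cancel.
- by apply: pres_eq_rel; apply: map_f.
Qed.

End Restrict.

Lemma subgroup_gen_sub (G : groupType) (S T : G -> Prop) g :
  (forall s, S s -> subgroup_gen T s) -> subgroup_gen S g -> subgroup_gen T g.
Proof.
move=> ST; elim=> {g} [g /ST //||g h _ gT _ hT|g _ gT].
- exact: subgroup_gen_1.
- exact: subgroup_gen_mul.
- exact: subgroup_gen_inv.
Qed.

Section Checker.

Import GroupScope.

Variables (D : finGroupType) (C : {group D}) (io : bool -> D -> D).

Local Notation label := (label D).

(* Source, label, target, and the word attached to an edge. *)
Definition edge := (nat * (label * (nat * word nat)))%type.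
Definition edge_word (e : edge) := e.2.2.2.
Definition edge_words (p : seq edge) := flatten [seq edge_word e | e <- p].

Definition label_inv (e : label) : label := (e.1, e.2^-1).
Definition path_inv (p : seq label) := rev [seq label_inv e | e <- p].

Definition path_subst (B : seq (seq label)) (w : word nat) : seq label :=
  flatten [seq (if l.2 then path_inv (nth [::] B l.1) else nth [::] B l.1) | l <- w].

Definition trivial_path (p : seq label) := run C io (start D) p == start D.

(* Relators are only produced from closed cycles, which avoids inverting words:
   an edge f closes the path carrying z when z followed by the word of f is a
   relator. *)
Definition closing (E : seq edge) (rels : seq (word nat)) v e u (z : word nat) :=
  has (fun f : edge => [&& f.1 == v, f.2.1 == e, f.2.2.1 == u & z ++ f.2.2.2 \in rels]) E.

Definition check_mul E rels := all (fun e : edge => all (fun e' : edge =>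
  ((e.2.2.1 == e'.1) && (e.2.1.1 == e'.2.1.1)) ==>
  closing E rels e'.2.2.1 (e.2.1.1, (e.2.1.2 * e'.2.1.2)^-1) e.1
    (e.2.2.2 ++ e'.2.2.2)) E) E.

Definition check_inv E rels := all (fun e : edge =>
  closing E rels e.2.2.1 (label_inv e.2.1) e.1 e.2.2.2) E.

Definition check_unit (E : seq edge) (rels : seq (word nat)) := all (fun e : edge =>
  (e.2.1.2 == 1) ==> ((e.2.2.1 == e.1) && (e.2.2.2 \in rels))) E.

(** Closing the edge of one colour by the inverse edge of the other forces both colours to lead to
    the same vertex, with words equal modulo the relators. *)
Definition check_edge E rels := all (fun e : edge => all (fun e' : edge =>
  ((e.1 == e'.1) && (e'.2.1.1 == ~~ e.2.1.1)) ==>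
  all (fun c => has (fun f : edge =>
    [&& f.1 == e.1, f.2.1 == (e.2.1.1, io e.2.1.1 c) &
        closing E rels f.2.2.1 (~~ e.2.1.1, (io (~~ e.2.1.1) c)^-1) e.1 f.2.2.2])
    E) (enum C)) E) E.

Definition check_fixed (E : seq edge) :=
  all (fun e : edge => io e.2.1.1 e.2.1.2 == e.2.1.2) E.

Definition reads (E : seq edge) (v : nat) (p : seq edge) (u : nat) :=
  foldl (fun (s : nat * bool) (e : edge) => (e.2.2.1, [&& s.2, e.1 == s.1 & e \in E]))
    (v, true) p == (u, true).

(* A loop at the base vertex 0 through one distinguished edge, which carries a
   generator; the words along the two tails are required to be relators, so that
   the whole loop is equivalent to that generator. *)
Definition lasso := (seq edge * (edge * seq edge))%type.

Definition lasso_labels (q : lasso) : seq label :=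
  [seq e.2.1 | e <- q.1 ++ q.2.1 :: q.2.2].

Definition check_lassos E (rels : seq (word nat)) (qs : seq lasso) :=
  all (fun q => [&& reads E 0 q.1 q.2.1.1, q.2.1 \in E, reads E q.2.1.2.2.1 q.2.2 0,
    edge_words q.1 \in rels & edge_words q.2.2 \in rels]) qs &&
  ([seq q.2.1.2.2.2 | q <- qs] == [seq [:: (i, false)] | i <- iota 0 (size qs)]).

Definition check_rels (gens : seq (seq label)) (rels : seq (word nat)) :=
  all (fun r => all (fun l => l.1 < size gens) r && trivial_path (path_subst gens r)) rels.

(** [cs] is a common pool of words, one of which must express each path of [A] through those of [B].
    Used in both directions, it gives equality of the generated subgroups. *)
Definition check_sub (A B : seq (seq label)) (cs : seq (word nat)) :=
  all (fun a => has (fun c => trivial_path (a ++ path_inv (path_subst B c))) cs) A.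

Definition certificate :=
  (seq edge * (seq lasso * (seq (word nat) * (seq (word nat) * seq (word nat)))))%type.

Definition cert_edges (c : certificate) := c.1.
Definition cert_lassos (c : certificate) := c.2.1.
Definition cert_rels (c : certificate) := c.2.2.1.
Definition cert_gens (c : certificate) := [seq lasso_labels q | q <- c.2.1].

Definition check (hs : seq (seq label)) (c : certificate) :=
  [&& check_mul c.1 c.2.2.1, check_inv c.1 c.2.2.1, check_unit c.1 c.2.2.1,
      check_edge c.1 c.2.2.1, check_fixed c.1, check_lassos c.1 c.2.2.1 c.2.1,
      check_rels (cert_gens c) c.2.2.1, check_sub hs (cert_gens c) c.2.2.2.1
    & check_sub (cert_gens c) hs c.2.2.2.2].

Hypothesis ioM : forall b, {morph io b : x y / x * y}.
Variables (G : groupType) (F : bool -> D -> G).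
Hypothesis FM : forall b, {morph F b : x y / x * y}.
Local Notation path_val := (path_val F).
Local Notation fixed := (all (fun e : label => io e.1 e.2 == e.2)).
Hypothesis trivial_pathP : forall p, fixed p -> path_val p = 1 <-> trivial_path p.

Lemma fixed_inv p : fixed p -> fixed (path_inv p).
Proof.
rewrite /path_inv all_rev all_map; apply: sub_all => -[b x] /= /eqP xE.
by rewrite ioV // xE.
Qed.

Lemma path_val_inv p : path_val (path_inv p) = (path_val p)^-1.
Proof. exact: path_val_rev. Qed.

Lemma fixed_subst B w : all fixed B -> fixed (path_subst B w).
Proof.
move=> fB; elim: w => [//|[i b] w IHw]; rewrite /path_subst /= all_cat IHw andbT.
have fi : fixed (nth [::] B i).
  case: (ltnP i (size B)) => iB; last by rewrite nth_default.
  exact: (allP fB _ (mem_nth _ iB)).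
by case: b; rewrite ?fixed_inv.
Qed.

Lemma path_val_subst B w :
  path_val (path_subst B w) = word_val (fun i => path_val (nth [::] B i)) w.
Proof.
elim: w => [|[i b] w IHw]; first by rewrite path_val_nil word_val_nil.
rewrite /path_subst /= path_val_cat IHw word_val_cons; congr (_ * _).
by case: b => //=; rewrite path_val_inv.
Qed.

Lemma check_subP A B cs a : all fixed A -> all fixed B -> check_sub A B cs ->
  a \in A -> subgroup_gen (fun g => g \in [seq path_val b | b <- B]) (path_val a).
Proof.
move=> fA fB /allP/(_ a) AB aA; have /hasP[c _] := AB aA.
move/trivial_pathP; rewrite all_cat (allP fA) // fixed_inv ?fixed_subst //.
move=> /(_ isT); rewrite path_val_cat path_val_inv path_val_subst => ac.
have -> : path_val a = word_val (fun i => path_val (nth [::] B i)) c.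
  by apply: (mulIg (word_val (fun i => path_val (nth [::] B i)) c)^-1); rewrite mulgV.
have : subgroup_gen (image_of (fun i => path_val (nth [::] B i)))
    (word_val (fun i => path_val (nth [::] B i)) c).
  by apply/subgroup_gen_word; exists c.
apply: subgroup_gen_sub => _ [i ->].
case: (ltnP i (size B)) => iB; first by apply: subgroup_gen_in; rewrite map_f ?mem_nth.
by rewrite nth_default // path_val_nil; apply: subgroup_gen_1.
Qed.

(** * Soundness of a checked certificate *)

Section Sound.

Variables (hs : seq (seq label)) (c : certificate).
Hypothesis fixed_hs : all fixed hs.
Hypothesis check_c : check hs c.

Let E := cert_edges c.
Let qs := cert_lassos c.
Let R := cert_rels c.
Let gens := cert_gens c.
Let Ed (v : nat) (e : label) (u : nat) (z : word nat) : Prop :=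
  (v, (e, (u, z))) \in E.

Local Notation "u =R v" := (pres_eq R u v) (at level 70).

Lemma closingP v e u z : closing E R v e u z ->
  exists2 z', Ed v e u z' & z' =R word_inv z.
Proof.
case/hasP=> -[v' [e' [u' z']]] fE /= /and4P[/eqP<- /eqP<- /eqP<- zR].
by exists z' => //; apply/pres_eq_invr/pres_eq_rel.
Qed.

Lemma cert_inv v b x u z :
  Ed v (b, x) u z -> exists2 z', Ed u (b, x^-1) v z' & z' =R word_inv z.
Proof. by case/and5P: check_c => _ /allP ck _ _ _ /ck/closingP. Qed.

Lemma cert_mul v b x u z y w z' : Ed v (b, x) u z -> Ed u (b, y) w z' ->
  exists2 z'', Ed v (b, x * y) w z'' & z ++ z' =R z''.
Proof.
move=> e e'; case/and5P: check_c => /allP/(_ _ e)/allP/(_ _ e').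
(* The closing edge runs backwards with the inverse label; inverting it yields the product edge. *)
rewrite /= !eqxx => /closingP[z1 /cert_inv[z2]]; rewrite invgK => f E2 E1 _ _ _ _.
by exists z2 => //; rewrite E2 E1 word_invK.
Qed.

Lemma cert_unit v b u z : Ed v (b, 1) u z -> u = v /\ z =R [::].
Proof.
move=> e; case/and5P: check_c => _ _ /allP/(_ _ e) /=; rewrite eqxx.
by case/andP=> /eqP-> zR _ _; split=> //; apply: pres_eq_rel.
Qed.

Lemma cert_edge v b x u z y w z' a :
  Ed v (b, x) u z -> Ed v (~~ b, y) w z' -> a \in C ->
  exists t z1 z2, [/\ Ed v (b, io b a) t z1, Ed v (~~ b, io (~~ b) a) t z2 & z1 =R z2].
Proof.
move=> e e' Ca; case/and5P: check_c => _ _ _ /allP/(_ _ e)/allP/(_ _ e').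
rewrite /= !eqxx /= => /allP/(_ a); rewrite mem_enum => /(_ Ca)/hasP[[v' [l [t z1]]]].
move=> f /and3P[/= /eqP v'E /eqP lE]; rewrite v'E lE in f.
case/closingP=> z2 /cert_inv[z3]; rewrite invgK => f' E3 E2 _.
by exists t, z1, z3; split=> //; rewrite E3 E2 word_invK.
Qed.

Lemma fixed_edges : fixed [seq e.2.1 | e <- E].
Proof. by rewrite all_map; case/and5P: check_c => _ _ _ _ /andP[]. Qed.

Lemma Ed_fixed v e u z : Ed v e u z -> io e.1 e.2 = e.2.
Proof. by move=> f; apply/eqP; apply: (allP fixed_edges); apply: (map_f _ f). Qed.

Lemma gpath_fixed v p u z : gpath Ed v p u z -> fixed p.
Proof.
elim: p v z => //= e p IHp v z [t [z1 [z2 [vt tu _]]]].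
by rewrite (Ed_fixed vt) eqxx (IHp _ _ tu).
Qed.

Lemma readsP v p u : reads E v p u ->
  gpath Ed v [seq e.2.1 | e <- p] u (edge_words p).
Proof.
have stuck v0 q : (foldl (fun (s : nat * bool) (e : edge) =>
    (e.2.2.1, [&& s.2, e.1 == s.1 & e \in E])) (v0, false) q).2 = false.
  by elim: q v0 => //= e q IHq v0; apply: IHq.
elim: p v => [|[v' [e [t z]]] p IHp] v; first by move/eqP=> [->].
rewrite /reads /=; case: (eqVneq v' v) => [->|_] /=; last first.
  by move/eqP/(congr1 snd); rewrite stuck.
case: (boolP (_ \in E)) => [f /IHp tu|_]; first by exists t, z, (edge_words p).
by move/eqP/(congr1 snd); rewrite stuck.
Qed.

Lemma cert_gen i : i < size qs -> exists2 z,
  gpath Ed 0 (nth [::] gens i) 0 z & z =R [:: (i, false)].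
Proof.
move=> iq; case/and5P: check_c => _ _ _ _ /and3P[_ /andP[/allP ck /eqP cz] _].
rewrite (nth_map ([::], ((0, ((true, 1), (0, [::]))), [::]))) //.
move: cz => /(congr1 (fun s => nth [::] s i)); set q0 := ([::], _).
rewrite (nth_map q0) // (nth_map 0) ?size_iota // nth_iota // add0n.
have := ck _ (mem_nth q0 iq); case: (nth q0 _ i) => p [[v [e [u z]]] p'] /=.
case/and5P=> /readsP vp f /readsP up pR p'R zE.
exists (edge_words p ++ z ++ edge_words p').
  rewrite /lasso_labels map_cat; apply: gpath_cat vp _.
  by exists u, z, (edge_words p').
by rewrite (pres_eq_rel pR) (pres_eq_rel p'R) cats0 zE.
Qed.

Lemma cert_gens_fixed : all fixed gens.
Proof.
apply/allP => p /(nthP [::])[i]; rewrite size_map => iq <-.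
by have [z /gpath_fixed] := cert_gen iq.
Qed.

Definition cert_val i := path_val (nth [::] gens i).

Lemma cert_rels_val r : r \in R -> word_val cert_val r = 1.
Proof.
move=> rR; case/and5P: check_c => _ _ _ _ /and3P[_ _ /andP[/allP/(_ _ rR)/andP[_ +] _]].
move/trivial_pathP; rewrite fixed_subst ?cert_gens_fixed // => /(_ isT).
by rewrite path_val_subst.
Qed.

(** Concatenated lassos, inverted where needed, turn a relation among the generators into a loop of
    the graph, to which [gpath_start] applies. *)
Lemma cert_loop w : all (fun l => l.1 < size qs) w -> exists p z,
  [/\ gpath Ed 0 p 0 z, z =R w & path_val p = word_val cert_val w].
Proof.
elim: w => [_|[i b] w IHw /= /andP[/cert_gen[z1 vi z1E] /IHw[p [z [vp zE pE]]]]].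
  by exists [::], [::]; rewrite path_val_nil word_val_nil.
rewrite word_val_cons /= -cat1s; case: b.
  have [z2 vi' z2E] := gpath_rev cert_inv vi.
  exists (path_inv (nth [::] gens i) ++ p), (z2 ++ z); split.
  - exact: gpath_cat vi' vp.
  - by rewrite zE z2E z1E.
  by rewrite path_val_cat path_val_inv pE.
exists (nth [::] gens i ++ p), (z1 ++ z); split.
- exact: gpath_cat vi vp.
- by rewrite zE z1E.
by rewrite path_val_cat pE.
Qed.

Lemma cert_kernel w : all (fun l => l.1 < size qs) w ->
  word_val cert_val w = 1 <-> w =R [::].
Proof.
move=> wq; split=> [w1|/(pres_eq_val cert_rels_val)->]; last exact: word_val_nil.
have [p [z [vp zw pE]]] := cert_loop wq.
apply: pres_eq_trans (pres_eq_sym zw) _.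
move: pE; rewrite w1 => /(trivial_pathP (gpath_fixed vp))/eqP.
exact: (gpath_start ioM cert_mul cert_inv cert_unit cert_edge vp).
Qed.

Lemma cert_generates g :
  subgroup_gen (fun g => g \in [seq path_val h | h <- hs]) g <->
  subgroup_gen (fun g => g \in [seq path_val h | h <- gens]) g.
Proof.
case/and5P: check_c => _ _ _ _ /and5P[_ _ _ hg gh].
split; apply: subgroup_gen_sub => _ /mapP[h hh ->].
  exact: (check_subP fixed_hs cert_gens_fixed hg).
exact: (check_subP cert_gens_fixed fixed_hs gh).
Qed.

Lemma cert_rels_bounded r : r \in R -> all (fun l => l.1 < size qs) r.
Proof.
case/and5P: check_c => _ _ _ _ /and3P[_ _ /andP[/allP ck _]] /ck/andP[+ _].
by rewrite size_map.
Qed.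

End Sound.

End Checker.

(** * Every subgroup has a certificate *)

Lemma all_has_witness (A B : eqType) (P : A -> B -> bool) s :
  (forall a, a \in s -> exists b, P a b) -> exists t, all (fun a => has (P a) t) s.
Proof.
elim: s => [|a s IHs] sP; first by exists [::].
have [b ab] := sP a (mem_head _ _).
have [|t tP] := IHs; first by move=> c cs; apply: sP; rewrite inE cs orbT.
by exists (b :: t); rewrite /= ab /=; apply: sub_all tP => c /= ->; rewrite orbT.
Qed.

Section Complete.

Import GroupScope.

Variables (D : finGroupType) (C : {group D}) (io : bool -> D -> D).
Hypothesis ioM : forall b, {morph io b : x y / x * y}.
Hypothesis ioK : forall b x, io b (io b x) = io b x.
Variables (G : groupType) (F : bool -> D -> G).
Hypothesis FM : forall b, {morph F b : x y / x * y}.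
Hypothesis F_edge : forall c, c \in C -> F false (io false c) = F true (io true c).
Local Notation label := (label D).
Local Notation path_val := (path_val F).
Local Notation fixed := (all (fun e : label => io e.1 e.2 == e.2)).
Local Notation trivial_path := (trivial_path C io).
Local Notation edge := (edge D).
Hypothesis trivial_pathP : forall p, fixed p -> path_val p = 1 <-> trivial_path p.

Variable hs : seq (seq label).
Hypothesis fixed_hs : all fixed hs.

(** Classical membership in H; it serves to prove that a certificate exists, never to run the
    algorithm. *)
Definition in_sub g := `[< subgroup_gen (fun g => g \in [seq path_val h | h <- hs]) g >].

Lemma in_sub1 : in_sub 1.
Proof. exact/asboolP/subgroup_gen_1. Qed.

Lemma in_subM g h : in_sub g -> in_sub h -> in_sub (g * h).
Proof. by move=> /asboolP gH /asboolP hH; apply/asboolP/subgroup_gen_mul. Qed.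

Lemma in_subV g : in_sub g -> in_sub g^-1.
Proof. by move=> /asboolP gH; apply/asboolP/subgroup_gen_inv. Qed.

Lemma in_sub_hs h : h \in hs -> in_sub (path_val h).
Proof. by move=> hh; apply/asboolP/subgroup_gen_in/map_f. Qed.

(** Proper prefixes suffice, since a label of [h] is read from the vertex of the prefix before it.
    The empty path is listed apart, to be present even when every [h] is empty. *)
Definition prefixes : seq (seq label) :=
  [::] :: flatten [seq [seq take k h | k <- iota 0 (size h)] | h <- hs].

(** The empty path comes first so that H itself gets number 0, the base vertex of the checker. *)
Definition vertices : seq (seq label) :=
  [::] :: [seq rcons p e | p <- prefixes, e <- [seq e <- enum {: label} | io e.1 e.2 == e.2]].

(* The right coset of g, numbered by the first listed path that reaches it. *)
Definition vertex g := find (fun q => in_sub (g * (path_val q)^-1)) vertices.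

Definition vertex_path g := nth [::] vertices (vertex g).

Definition vertex_rep g := path_val (vertex_path g).

(** The coset of such a [g] is a vertex of colour [b]. Closure under right multiplication by the
    factor ([reachedM]) lets a vertex that meets a colour carry all edges of that colour. *)
Definition reached b g := exists p x,
  [/\ p \in prefixes, io b x = x & g = path_val p * F b x].

Lemma eq_vertex g h : in_sub (g * h^-1) -> vertex g = vertex h.
Proof.
move=> gh; apply: eq_find => q; apply/idP/idP => [gq|hq].
  by have := in_subM (in_subV gh) gq; rewrite invMg invgK -mulgA mulKg.
by have := in_subM gh hq; rewrite -mulgA mulKg.
Qed.

Lemma in_sub_rep b g : reached b g -> in_sub (g * (vertex_rep g)^-1).
Proof.
move=> [p [x [pp xx ->]]].
apply: (@nth_find _ [::] (fun q => in_sub (_ * (path_val q)^-1))).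
apply/hasP; exists (rcons p (b, x)).
  rewrite inE; apply/orP; right; apply/allpairsP; exists (p, (b, x)); split=> //=.
  by rewrite mem_filter /= xx eqxx mem_enum.
by rewrite -cats1 path_val_cat path_val_cons path_val_nil mulg1 mulgV in_sub1.
Qed.

Lemma vertex_rep_vertex b g : reached b g -> vertex (vertex_rep g) = vertex g.
Proof.
by move=> /in_sub_rep/in_subV gg; apply: eq_vertex; rewrite invMg invgK in gg.
Qed.

(** Elements whose coset is not listed all share the number [size vertices]; the two [reached]
    hypotheses exclude this. *)
Lemma eq_vertex_sub b b' g h : reached b g -> reached b' h -> vertex g = vertex h ->
  in_sub (g * h^-1).
Proof.
move=> /in_sub_rep gg /in_sub_rep hh gh.
have := in_subM gg (in_subV hh); rewrite /vertex_rep /vertex_path gh.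
by rewrite invMg invgK mulgA mulgKV.
Qed.

Lemma in_sub_vertex g : in_sub g -> vertex g = 0.
Proof. by move=> gH; rewrite /vertex /= path_val_nil invg1 mulg1 gH. Qed.

Lemma in_sub_vertex_rep g : in_sub g -> vertex_rep g = 1.
Proof.
by move=> /in_sub_vertex g0; rewrite /vertex_rep /vertex_path g0 path_val_nil.
Qed.

Lemma reachedM b g y : reached b g -> io b y = y -> reached b (g * F b y).
Proof.
move=> [p [x [pp xx ->]]] yy; exists p, (x * y).
by rewrite ioM xx yy FM mulgA.
Qed.

Lemma reached_prefix b p : p \in prefixes -> reached b (path_val p).
Proof. by move=> pp; exists p, 1; rewrite io1 // (factor_val1 FM) mulg1. Qed.

(** The Schreier generator of an edge. Products along consecutive edges telescope, which makes the
    required triangle relations true. *)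
Definition cocycle g (e : label) :=
  vertex_rep g * F e.1 e.2 * (vertex_rep (g * F e.1 e.2))^-1.

Definition base_elements : seq (G * label) :=
  [seq (path_val p * F t.1 t.2.1, (t.1, t.2.2)) | p <- prefixes,
    t <- [seq t <- enum {: bool * (D * D)} |
          (io t.1 t.2.1 == t.2.1) && (io t.1 t.2.2 == t.2.2)]].

Lemma base_elementsP t : reflect (reached t.2.1 t.1 /\ io t.2.1 t.2.2 = t.2.2)
  (t \in base_elements).
Proof.
apply: (iffP idP).
  case/allpairsP=> -[p [b [x y]]] /= [pp].
  rewrite mem_filter /= => /andP[/andP[/eqP xx /eqP yy] _] ->.
  by split=> //; exists p, x.
case: t => g [b y] /= [[p [x [pp xx ->]]] yy].
apply/allpairsP; exists (p, (b, (x, y))); split=> //=.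
by rewrite mem_filter /= xx yy !eqxx mem_enum.
Qed.

(** Edges with equal Schreier generators share a letter, and the trivial one gets the empty word, so
    the word of an edge depends only on the coset at its source and its label. *)
Definition sub_gens : seq G :=
  undup [seq u <- [seq cocycle t.1 t.2 | t <- base_elements] | u != 1].

Definition gen_letter (u : G) : word nat :=
  if u == 1 then [::] else [:: (index u sub_gens, false)].

Definition coset_edge g (e : label) : edge :=
  (vertex g, (e, (vertex (g * F e.1 e.2), gen_letter (cocycle g e)))).

Definition coset_edges : seq edge := [seq coset_edge t.1 t.2 | t <- base_elements].

Lemma mem_coset_edges g b y : reached b g -> io b y = y ->
  coset_edge g (b, y) \in coset_edges.
Proof. by move=> bg yy; apply: (map_f _ (introT (base_elementsP (g, (b, y))) (conj bg yy))). Qed.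

Lemma coset_edgesP e : e \in coset_edges -> exists g b y,
  [/\ reached b g, io b y = y & e = coset_edge g (b, y)].
Proof. by case/mapP=> -[g [b y]] /base_elementsP[/= bg yy] ->; exists g, b, y. Qed.

Lemma cocycle_gens g b y : reached b g -> io b y = y ->
  cocycle g (b, y) \in 1 :: sub_gens.
Proof.
move=> bg yy; rewrite inE mem_undup mem_filter; case: eqP => //= _.
exact: (map_f _ (introT (base_elementsP (g, (b, y))) (conj bg yy))).
Qed.

Lemma eq_cocycle g h e : in_sub (g * h^-1) -> cocycle g e = cocycle h e.
Proof.
move=> gh; rewrite /cocycle /vertex_rep /vertex_path (eq_vertex gh).
suff /eq_vertex-> : in_sub (g * F e.1 e.2 * (h * F e.1 e.2)^-1) by [].
by rewrite invMg mulgA mulgK.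
Qed.

Lemma cocycle_sub b g y : reached b g -> io b y = y -> in_sub (cocycle g (b, y)).
Proof.
move=> bg yy; have := in_sub_rep (reachedM bg yy); move: (in_sub_rep bg) => /in_subV.
rewrite invMg invgK => /in_subM h /h; rewrite /cocycle.
by rewrite !mulgA mulgKV.
Qed.

Fixpoint walk g (q : seq label) : Prop :=
  if q is e :: q' then [/\ reached e.1 g, io e.1 e.2 = e.2 & walk (g * F e.1 e.2) q']
  else True.

Fixpoint lift g (q : seq label) : seq edge :=
  if q is e :: q' then coset_edge g e :: lift (g * F e.1 e.2) q' else [::].

Lemma walk_cat g p q : walk g p -> walk (g * path_val p) q -> walk g (p ++ q).
Proof.
elim: p g => [|e p IHp] g /=; first by rewrite path_val_nil mulg1.
by case=> eg ee gp; rewrite path_val_cons mulgA => pq; split=> //; apply: IHp.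
Qed.

Lemma walk_inv g q : walk g q -> walk (g * path_val q) (path_inv q).
Proof.
elim: q g => // -[b x] q IHq g /= [bg xx gq].
rewrite path_val_cons mulgA /path_inv /= rev_cons -cats1; apply: walk_cat.
  exact: IHq.
rewrite path_val_inv // mulgK /=; split=> //; first exact: reachedM.
by rewrite ioV // xx.
Qed.

Lemma lift_labels g q : [seq e.2.1 | e <- lift g q] = q.
Proof. by elim: q g => //= e q IHq g; rewrite IHq. Qed.

Lemma lift_reads g q : walk g q ->
  reads coset_edges (vertex g) (lift g q) (vertex (g * path_val q)).
Proof.
elim: q g => [|[b x] q IHq] g /=; first by rewrite path_val_nil mulg1 /reads /=.
case=> bg xx /IHq; rewrite /reads /= eqxx mem_coset_edges //=.
by rewrite path_val_cons mulgA.
Qed.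

Lemma lift_edges g q : walk g q -> {subset lift g q <= coset_edges}.
Proof.
elim: q g => //= -[b x] q IHq g [bg xx /IHq gq] e; rewrite inE.
by case/predU1P=> [->|/gq //]; apply: mem_coset_edges.
Qed.

Definition gen_val i := nth 1 sub_gens i.

Lemma gen_letter_val u : u \in 1 :: sub_gens -> word_val gen_val (gen_letter u) = u.
Proof.
rewrite inE /gen_letter; case: eqP => [-> _|_ /= uS]; first exact: word_val_nil.
by rewrite word_val_cons word_val_nil mulg1 /= /gen_val nth_index.
Qed.

Lemma lift_val g q : walk g q -> word_val gen_val (edge_words (lift g q)) =
  vertex_rep g * path_val q * (vertex_rep (g * path_val q))^-1.
Proof.
elim: q g => [|[b x] q IHq] g /=.
  by rewrite word_val_nil path_val_nil !mulg1 mulgV.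
case=> bg xx gq; rewrite /edge_words /= word_val_cat IHq // path_val_cons.
rewrite gen_letter_val ?cocycle_gens // /cocycle /=.
by rewrite !mulgA mulgKV.
Qed.

Definition bounded := all (fun l : nat * bool => l.1 < size sub_gens).

Lemma gen_letter_bounded u : u \in 1 :: sub_gens -> bounded (gen_letter u).
Proof.
rewrite inE /gen_letter; case: eqP => //= _ uS.
by rewrite /bounded /= index_mem uS.
Qed.

Lemma lift_bounded g q : walk g q -> bounded (edge_words (lift g q)).
Proof.
elim: q g => [//|[b x] q IHq] g /= [bg xx gq].
rewrite /edge_words /= /bounded all_cat -/bounded gen_letter_bounded ?cocycle_gens //.
exact: IHq.
Qed.

Lemma walk_take q k : (forall j, j < k -> take j q \in prefixes) -> fixed q ->
  walk 1 (take k q).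
Proof.
elim: k => [|k IHk] kq fq; first by rewrite take0.
case: (ltnP k (size q)) => kn; last first.
  rewrite take_oversize; last exact: leqW.
  by rewrite -[q](take_oversize kn); apply: IHk => // j jk; apply: kq; apply: leqW.
rewrite (take_nth (true, 1)) // -cats1; apply: walk_cat.
  by apply: IHk => // j jk; apply: kq; apply: leqW.
rewrite mul1g /=; split=> //; first exact/reached_prefix/kq.
by apply/eqP; apply: (allP fq); apply: mem_nth.
Qed.

Lemma prefixesP p : p \in prefixes -> p = [::] \/
  exists h k, [/\ h \in hs, k < size h & p = take k h].
Proof.
rewrite inE => /predU1P[->|/flatten_mapP[h hh /mapP[k]]]; first by left.
by rewrite mem_iota add0n /= => kh ->; right; exists h, k.
Qed.

Lemma take_prefixes h k : h \in hs -> k < size h -> take k h \in prefixes.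
Proof.
move=> hh kh; rewrite inE; apply/orP; right; apply/flatten_mapP; exists h => //.
by apply: map_f; rewrite mem_iota.
Qed.

Lemma walk_prefix p : p \in prefixes -> walk 1 p.
Proof.
case/prefixesP=> [->//|[h [k [hh kh ->]]]]; apply: walk_take (allP fixed_hs _ hh) => j jk.
exact: take_prefixes (ltn_trans jk kh).
Qed.

Lemma walk_hs h : h \in hs -> walk 1 h.
Proof.
move=> hh; rewrite -[h]take_size; apply: walk_take (allP fixed_hs _ hh) => j.
exact: take_prefixes.
Qed.

Lemma walk_vertex_path b g : reached b g -> walk 1 (vertex_path g).
Proof.
move=> bg; have: vertex_path g \in vertices.
  rewrite mem_nth // -has_find; have [p [x [pp xx gE]]] := bg.
  apply/hasP; exists (rcons p (b, x)).
    rewrite inE; apply/orP; right; apply/allpairsP; exists (p, (b, x)); split=> //=.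
    by rewrite mem_filter /= xx eqxx mem_enum.
  by rewrite -cats1 path_val_cat path_val_cons path_val_nil mulg1 -gE mulgV in_sub1.
rewrite inE => /predU1P[->//|/allpairsP[[p e] /= [pp]]].
rewrite mem_filter => /andP[/eqP ee _] ->; rewrite -cats1; apply: walk_cat.
  exact: walk_prefix.
by rewrite mul1g /=; split=> //; apply: reached_prefix.
Qed.

(** The way back starts from the representative of the end coset rather than from [g']: the vertex
    is the same, and the inverted path undoes the representative exactly. *)
Definition coset_lasso (t : G * label) : lasso D :=
  let g' := t.1 * F t.2.1 t.2.2 in
  (lift 1 (vertex_path t.1),
    (coset_edge t.1 t.2, lift (vertex_rep g') (path_inv (vertex_path g')))).

Definition lasso_base u := nth (1, (true, 1)) base_elements
  (index u [seq cocycle t.1 t.2 | t <- base_elements]).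

Lemma lasso_baseP u : u \in sub_gens ->
  lasso_base u \in base_elements /\ cocycle (lasso_base u).1 (lasso_base u).2 = u.
Proof.
rewrite mem_undup mem_filter => /andP[_ uS]; split.
  by rewrite mem_nth // -(size_map (fun t => cocycle t.1 t.2)) index_mem.
rewrite -(nth_map _ 1 (fun t => cocycle t.1 t.2)) ?nth_index //.
by rewrite -(size_map (fun t => cocycle t.1 t.2)) index_mem.
Qed.

Definition coset_lassos := [seq coset_lasso (lasso_base u) | u <- sub_gens].

(** Closing conditions involve at most three Schreier generators, so all true triangles suffice for
    them. The tails are added because the chosen paths need not form a Schreier transversal: their
    words may be nonempty, but their values telescope to 1. *)
Definition coset_rels : seq (word nat) :=
  [seq gen_letter t.1 ++ gen_letter t.2.1 ++ gen_letter t.2.2 |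
     t <- [seq t <- [seq (a, t) | a <- 1 :: sub_gens,
                        t <- [seq (b, c) | b <- 1 :: sub_gens, c <- 1 :: sub_gens]] |
             t.1 * (t.2.1 * t.2.2) == 1]] ++
  [seq edge_words q.1 | q <- coset_lassos] ++ [seq edge_words q.2.2 | q <- coset_lassos].

Lemma triangle_rel a b c : a \in 1 :: sub_gens -> b \in 1 :: sub_gens ->
  c \in 1 :: sub_gens -> a * (b * c) = 1 ->
  gen_letter a ++ gen_letter b ++ gen_letter c \in coset_rels.
Proof.
move=> aS bS cS abc; rewrite mem_cat; apply/orP; left.
apply/mapP; exists (a, (b, c)) => //; rewrite mem_filter; apply/andP; split.
  exact/eqP.
apply/allpairsP; exists (a, (b, c)); split=> //.
by apply/allpairsP; exists (b, c).
Qed.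

Lemma reached_lasso u : u \in sub_gens -> exists g b y,
  [/\ reached b g, io b y = y, lasso_base u = (g, (b, y)) & cocycle g (b, y) = u].
Proof.
move=> /lasso_baseP[]; case: (lasso_base u) => g [b y] /base_elementsP[/= bg yy] cu.
by exists g, b, y.
Qed.

Lemma walk_back b g : reached b g -> walk (vertex_rep g) (path_inv (vertex_path g)).
Proof. by move=> /walk_vertex_path/walk_inv; rewrite mul1g. Qed.

Lemma vertex_rep_idem b g : reached b g -> vertex_rep (vertex_rep g) = vertex_rep g.
Proof.
by move=> bg; rewrite {1}/vertex_rep /vertex_path (vertex_rep_vertex bg).
Qed.

Lemma there_val b g : reached b g ->
  word_val gen_val (edge_words (lift 1 (vertex_path g))) = 1.
Proof.
move=> bg; rewrite lift_val; last exact: walk_vertex_path bg.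
rewrite in_sub_vertex_rep ?in_sub1 // !mul1g -/(vertex_rep g).
by rewrite (vertex_rep_idem bg) mulgV.
Qed.

Lemma back_val b g : reached b g ->
  word_val gen_val (edge_words (lift (vertex_rep g) (path_inv (vertex_path g)))) = 1.
Proof.
move=> bg; rewrite lift_val; last exact: walk_back bg.
rewrite path_val_inv // (vertex_rep_idem bg) -/(vertex_rep g) mulgV.
by rewrite in_sub_vertex_rep ?in_sub1 // mulgV.
Qed.

Lemma coset_rels_val r : r \in coset_rels -> bounded r /\ word_val gen_val r = 1.
Proof.
rewrite !mem_cat => /or3P[/mapP[[a [b c]]]|
    /mapP[_ /mapP[u /reached_lasso[g [b [y [bg yy -> _]]]] ->] ->]|
    /mapP[_ /mapP[u /reached_lasso[g [b [y [bg yy -> _]]]] ->] ->]].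
- rewrite mem_filter => /andP[/eqP abc /allpairsP[[a' t'] [aS + E]]].
  move: E aS => [<- <-] aS /allpairsP[[b' c'] [+ + E]].
  move: E => [<- <-] bS cS ->; rewrite !word_val_cat !gen_letter_val // abc; split=> //.
  by rewrite /bounded !all_cat -/bounded !gen_letter_bounded.
- by split; [apply/lift_bounded/(walk_vertex_path bg)|apply: there_val bg].
have bg' := reachedM bg yy.
by split; [apply/lift_bounded/(walk_back bg')|apply: back_val bg'].
Qed.

Lemma coset_closing g b y z : reached b g -> io b y = y ->
  z ++ gen_letter (cocycle g (b, y)) \in coset_rels ->
  closing coset_edges coset_rels (vertex g) (b, y) (vertex (g * F b y)) z.
Proof.
move=> bg yy zR; apply/hasP; exists (coset_edge g (b, y)).
  exact: mem_coset_edges.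
by rewrite /= !eqxx.
Qed.

Lemma coset_check_mul : check_mul coset_edges coset_rels.
Proof.
apply/allP => e /coset_edgesP[g [b [x [bg xx ->]]]].
apply/allP => e' /coset_edgesP[h [b' [y [bh yy ->]]]].
apply/implyP => /andP[/= /eqP gh /eqP bb']; rewrite -bb' in bh yy |- *.
have bgx := reachedM bg xx; have {}gh := eq_vertex_sub bgx bh gh.
rewrite -(eq_cocycle (b, y) gh).
have -> : vertex (h * F b y) = vertex (g * F b (x * y)).
  apply/esym/eq_vertex; rewrite FM mulgA invMg mulgA.
  by rewrite mulgK.
have xyy : io b (x * y)^-1 = (x * y)^-1 by rewrite ioV // ioM xx yy.
have bgxy : reached b (g * F b (x * y)) by apply: reachedM; rewrite // ioM xx yy.
(* [coset_closing] expects its target as a product, so [g] is written as the end of the inverse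
   edge. *)
have gE : g * F b (x * y) * F b (x * y)^-1 = g by rewrite (factor_valV FM) mulgK.
rewrite -[in vertex g]gE; apply: coset_closing => //.
rewrite -catA; apply: triangle_rel; rewrite ?cocycle_gens //.
by rewrite /cocycle /= gE (factor_valV FM) FM invMg !mulgA !mulgKV !mulgK mulgV.
Qed.

Lemma coset_check_inv : check_inv coset_edges coset_rels.
Proof.
apply/allP => e /coset_edgesP[g [b [x [bg xx ->]]]].
have gE : g * F b x * F b x^-1 = g by rewrite (factor_valV FM) mulgK.
have bgx := reachedM bg xx; have xx' : io b x^-1 = x^-1 by rewrite ioV // xx.
rewrite /= -[in vertex g]gE; apply: coset_closing => //.
(* A relation between two generators is padded to a triangle by the empty word for 1. *)
have -> : gen_letter (cocycle g (b, x)) = gen_letter 1 ++ gen_letter (cocycle g (b, x)).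
  by rewrite /gen_letter eqxx.
rewrite -catA; apply: triangle_rel; rewrite ?cocycle_gens ?mem_head //.
by rewrite /cocycle /= gE (factor_valV FM) mul1g !mulgA mulgKV mulgK mulgV.
Qed.

Lemma coset_check_unit : check_unit coset_edges coset_rels.
Proof.
apply/allP => e /coset_edgesP[g [b [x [bg xx ->]]]]; apply/implyP => /= /eqP->.
rewrite /coset_edge /cocycle /= (factor_val1 FM) !mulg1 eqxx mulgV.
have := @triangle_rel 1 1 1; rewrite mem_head !mulg1 => /(_ isT isT isT erefl).
by rewrite /gen_letter eqxx.
Qed.

Lemma coset_check_edge : check_edge C io coset_edges coset_rels.
Proof.
apply/allP => e /coset_edgesP[g [b [x [bg xx ->]]]].
apply/allP => e' /coset_edgesP[h [b' [y [bh yy ->]]]].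
apply/implyP => /andP[/= /eqP gh /eqP bb']; rewrite {}bb' in bh yy *.
have {}gh := eq_vertex_sub bg bh gh.
apply/allP => c; rewrite mem_enum => Cc; apply/hasP.
exists (coset_edge g (b, io b c)); first exact: mem_coset_edges bg (ioK b c).
rewrite /= !eqxx /=.
(* Both colours multiply by the same element of G, so the end cosets and the cocycles agree. *)
have Fc : F b (io b c) = F (~~ b) (io (~~ b) c) by exact: (@F_edge_color D C io G F F_edge).
have bhc := reachedM bh (ioK (~~ b) c).
have hc : in_sub (g * F b (io b c) * (h * F (~~ b) (io (~~ b) c))^-1).
  by rewrite Fc invMg mulgA mulgK.
have hE : h * F (~~ b) (io (~~ b) c) * F (~~ b) (io (~~ b) c)^-1 = h.
  by rewrite (factor_valV FM) mulgK.
have io' : io (~~ b) (io (~~ b) c)^-1 = (io (~~ b) c)^-1 by rewrite ioV // ioK.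
have bgc := reachedM bg (ioK b c).
rewrite (eq_vertex hc) (eq_vertex gh) -[in vertex h]hE; apply: coset_closing => //.
have -> : gen_letter (cocycle g (b, io b c)) =
    gen_letter 1 ++ gen_letter (cocycle g (b, io b c)).
  by rewrite /gen_letter eqxx.
rewrite -catA; apply: triangle_rel; rewrite ?cocycle_gens ?ioK ?mem_head //.
rewrite (eq_cocycle _ gh) /cocycle /= hE Fc (factor_valV FM) mul1g.
by rewrite !mulgA mulgKV mulgK mulgV.
Qed.

Lemma coset_check_fixed : check_fixed io coset_edges.
Proof. by apply/allP => e /coset_edgesP[g [b [x [bg xx ->]]]]; apply/eqP. Qed.

Lemma coset_check_lassos : check_lassos coset_edges coset_rels coset_lassos.
Proof.
apply/andP; split; last first.
  apply/eqP; apply: (@eq_from_nth _ [::]); rewrite !size_map ?size_iota // => i iS.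
  rewrite -map_comp (nth_map 1) // (nth_map 0) ?size_iota // nth_iota // add0n.
  have uS := mem_nth 1 iS; have [g [b [y [bg yy uE cu]]]] := reached_lasso uS.
  rewrite /= uE cu /gen_letter index_uniq ?undup_uniq // ifN //.
  by move: uS; rewrite mem_undup mem_filter => /andP[].
apply/allP => q qq; have /mapP[u uS qE] := qq.
have [g [b [y [bg yy uE cu]]]] := reached_lasso uS; rewrite uE in qE.
have bgy := reachedM bg yy.
have R1 : edge_words q.1 \in coset_rels.
  by rewrite !mem_cat; apply/or3P/Or32/map_f.
have R2 : edge_words q.2.2 \in coset_rels.
  by rewrite !mem_cat; apply/or3P/Or33/map_f.
rewrite R1 R2 andbT qE /=; apply/and3P; split.
- have := lift_reads (walk_vertex_path bg).
  rewrite mul1g -/(vertex_rep g) (vertex_rep_vertex bg).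
  by rewrite (in_sub_vertex in_sub1).
- exact: mem_coset_edges.
have := lift_reads (walk_back bgy).
by rewrite path_val_inv // mulgV (in_sub_vertex in_sub1) (vertex_rep_vertex bgy) andbT.
Qed.

Lemma coset_gen_val i : i < size coset_lassos ->
  path_val (nth [::] [seq lasso_labels q | q <- coset_lassos] i) = gen_val i.
Proof.
rewrite size_map => iS; rewrite -map_comp (nth_map 1) //=.
have uS := mem_nth 1 iS; have [g [b [y [bg yy uE cu]]]] := reached_lasso uS.
rewrite uE /lasso_labels map_cat /= !lift_labels path_val_cat path_val_cons.
by rewrite path_val_inv // -[RHS]cu /cocycle /= !mulgA.
Qed.

Lemma coset_gens_fixed : all fixed [seq lasso_labels q | q <- coset_lassos].
Proof.
apply/allP => _ /mapP[_ /mapP[u /reached_lasso[g [b [y [bg yy -> _]]]] ->] ->].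
have bgy := reachedM bg yy.
rewrite all_map; apply/allP => e; rewrite mem_cat inE => ee.
suff eE : e \in coset_edges by apply: (allP coset_check_fixed).
case/or3P: ee => [|/eqP->|].
- exact: lift_edges (walk_vertex_path bg) _.
- exact: mem_coset_edges.
- exact: lift_edges (walk_back bgy) _.
Qed.

Lemma gen_val_bounded w : bounded w -> word_val (fun i =>
    path_val (nth [::] [seq lasso_labels q | q <- coset_lassos] i)) w = word_val gen_val w.
Proof.
elim: w => [_|[i b] w IHw /= /andP[iS /IHw wE]]; first by rewrite !word_val_nil.
by rewrite !word_val_cons wE /= coset_gen_val // size_map.
Qed.

Lemma coset_check_rels :
  check_rels C io [seq lasso_labels q | q <- coset_lassos] coset_rels.
Proof.
apply/allP => r /coset_rels_val[br rE]; apply/andP; split.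
  by rewrite !size_map; apply: br.
apply/trivial_pathP; first by rewrite fixed_subst // coset_gens_fixed.
by rewrite path_val_subst // gen_val_bounded.
Qed.

Lemma exists_check_sub A B : all fixed A -> all fixed B ->
  (forall a, a \in A -> subgroup_gen (image_of (fun i => path_val (nth [::] B i)))
     (path_val a)) ->
  exists cs, check_sub C io A B cs.
Proof.
move=> fA fB AB; apply: all_has_witness => a aA.
have /subgroup_gen_word[w aE] := AB a aA; exists w; apply/trivial_pathP.
  by rewrite all_cat (allP fA) // fixed_inv // fixed_subst.
by rewrite path_val_cat path_val_inv // path_val_subst // aE mulgV.
Qed.

Lemma in_sub_image g : in_sub g ->
  subgroup_gen (image_of (fun i => path_val (nth [::] hs i))) g.
Proof.
move/asboolP; apply: subgroup_gen_sub => _ /mapP[h /(nthP [::])[i _ <-] ->].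
by apply: subgroup_gen_in; exists i.
Qed.

Lemma exists_certificate : exists c, check C io hs c.
Proof.
set gens := [seq lasso_labels q | q <- coset_lassos].
have [cs csP] : exists cs, check_sub C io hs gens cs.
  apply: exists_check_sub => //; first exact: coset_gens_fixed.
  move=> h hh; apply/subgroup_gen_word.
  (* The lift of [h] is a closed walk at the base; the representatives at its ends are 1, so its
     word has the value of [h]. *)
  exists (edge_words (lift 1 h)); rewrite gen_val_bounded; last first.
    exact/lift_bounded/walk_hs.
  rewrite lift_val; last exact: walk_hs.
  by rewrite mul1g !in_sub_vertex_rep ?in_sub1 ?in_sub_hs // mul1g invg1 mulg1.
have [ds dsP] : exists ds, check_sub C io gens hs ds.
  apply: exists_check_sub => //; first exact: coset_gens_fixed.
  move=> a /(nthP [::])[i]; rewrite size_map => iS <-; apply: in_sub_image.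
  rewrite coset_gen_val //; rewrite size_map in iS.
  have [g [b [y [bg yy _ cu]]]] := reached_lasso (mem_nth 1 iS).
  by rewrite /gen_val -cu; apply: cocycle_sub.
exists (coset_edges, (coset_lassos, (coset_rels, (cs, ds)))).
rewrite /check /= csP dsP coset_check_mul coset_check_inv coset_check_unit.
by rewrite coset_check_edge coset_check_fixed coset_check_lassos coset_check_rels.
Qed.

End Complete.

(** * Checking certificates is computable *)

Lemma computable_andb (T : countType) (f g : T -> bool) :
  computable f -> computable g -> computable (fun x => f x && g x).
Proof. exact: computable_fin2. Qed.

Lemma computable_implyb (T : countType) (f g : T -> bool) :
  computable f -> computable g -> computable (fun x => f x ==> g x).
Proof. exact: computable_fin2. Qed.

Lemma computable_negb (T : countType) (f : T -> bool) :
  computable f -> computable (fun x => ~~ f x).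
Proof. exact: computable_fin. Qed.

(** Syntax-directed: each clause matches the head of the body and abstracts its arguments over the
    input. The constant clause fires only on bodies that do not mention the input. *)
Ltac computable_step :=
  match goal with
  | H : computable ?f |- computable ?f => exact: H
  | |- computable (@fst _ _) => exact: (computable_fst (computable_id _))
  | |- computable (@snd _ _) => exact: (computable_snd (computable_id _))
  | |- computable (fun x => x) => exact: computable_id
  | |- computable (fun x => ?c) => exact: computable_const
  | |- computable (fun x => (@?f x, @?g x)) => apply: (@computable_pair _ _ _ f g)
  | |- computable (fun x => fst (@?f x)) => apply: (@computable_fst _ _ _ f)
  | |- computable (fun x => snd (@?f x)) => apply: (@computable_snd _ _ _ f)
  | |- computable (fun x => cons (@?f x) (@?g x)) => apply: (@computable_cons _ _ f g)
  | |- computable (fun x => cat (@?f x) (@?g x)) => apply: (@computable_cat _ _ f g)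
  | |- computable (fun x => nth ?z (@?f x) (@?g x)) => apply: (@computable_nth _ _ z f g)
  | |- computable (fun x => rev (@?f x)) => apply: (@computable_rev _ _ f)
  | |- computable (fun x => iota 0 (size (@?f x))) => apply: (@computable_iota0 _ _ f)
  | |- computable (fun x => size (@?f x)) => apply: (@computable_size _ _ f)
  | |- computable (fun x => flatten (@?f x)) => apply: (@computable_flatten _ _ f)
  | |- computable (fun x => map (@?f x) (@?g x)) => apply: (@computable_map _ _ _ f g)
  | |- computable (fun x => all (@?f x) (@?g x)) => apply: (@computable_all _ _ f g)
  | |- computable (fun x => has (@?f x) (@?g x)) => apply: (@computable_has _ _ f g)
  | |- computable (fun x => (@?f x) && (@?g x)) => apply: (@computable_andb _ f g)
  | |- computable (fun x => (@?f x) ==> (@?g x)) => apply: (@computable_implyb _ f g)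
  | |- computable (fun x => ~~ (@?f x)) => apply: (@computable_negb _ f)
  | |- computable (fun x => (@?f x) == (@?g x)) => apply: (@computable_eq _ _ f g)
  | |- computable (fun x => S (@?f x)) => apply: (@computable_succ _ f)
  | |- computable (fun x => leq (@?f x) (@?g x)) => apply: (@computable_leq _ f g)
  | |- computable (fun x => (@?f x) \in (@?g x)) => apply: (@computable_mem _ _ f g)
  | H : computable ?f |- computable (fun x => ?f (@?g x)) =>
      apply: (@computable_comp _ _ _ f g H)
  | |- computable (fun x => match _ with true => _ | false => _ end) => apply: computable_if
  end; cbv beta.

Section ComputableCheck.

Import GroupScope.

Lemma computable_mulg (T : countType) (H : finGroupType) (f g : T -> H) :
  computable f -> computable g -> computable (fun x => f x * g x).
Proof. exact: (computable_fin2 (fun a b => a * b)). Qed.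

Lemma computable_invg (T : countType) (H : finGroupType) (f : T -> H) :
  computable f -> computable (fun x => (f x)^-1).
Proof. exact: (computable_fin (fun a => a^-1)). Qed.

Variables (D : finGroupType) (C : {group D}) (io : bool -> D -> D).

Lemma computable_io (T : countType) (b : T -> bool) (x : T -> D) :
  computable b -> computable x -> computable (fun t => io (b t) (x t)).
Proof. exact: computable_fin2. Qed.

Ltac group_step := first [ computable_step
  | match goal with
    | |- computable (fun x => (@?f x) * (@?g x)) => apply: (@computable_mulg _ _ f g)
    | |- computable (fun x => (@?f x)^-1) => apply: (@computable_invg _ _ f)
    | |- computable (fun x => io (@?f x) (@?g x)) => apply: (@computable_io _ f g)
    end; cbv beta ].

Lemma computable_unfold_state (T : countType) (b : T -> bool) (s : T -> state D) :
  computable b -> computable s -> computable (fun x => unfold_state io (b x) (s x)).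
Proof.
move=> cb cs; apply: (@computable_case _ _ _ (fun x => (s x).1)
  (fun x => ((s x).1, io (b x) (s x).2))
  (fun x e l => if e.1 == b x then (l, e.2 * io (b x) (s x).2)
                else ((s x).1, io (b x) (s x).2))); repeat group_step.
Qed.

Lemma computable_fold_state (T : countType) (b : T -> bool) (s : T -> state D) :
  computable b -> computable s -> computable (fun x => fold_state C io (b x) (s x)).
Proof.
move=> cb cs; have cr : computable (fun x => coset_rep C io (b x) (s x).2).
  by apply: computable_fin2 => //; repeat group_step.
have cd : computable (fun x =>
    edge_pre C io (b x) ((coset_rep C io (b x) (s x).2)^-1 * (s x).2)).
  by apply: computable_fin2 => //; repeat group_step.
by rewrite /fold_state; repeat group_step.
Qed.

Lemma computable_run (T : countType) (p : T -> seq (label D)) :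
  computable p -> computable (fun x => run C io (start D) (p x)).
Proof.
move=> cp; apply: (@computable_foldl _ _ _ (fun _ => step C io)) => //.
  exact: computable_const.
apply: (@computable_fold_state _ (fun p => p.2.2.1) (fun p =>
  let t := unfold_state io p.2.2.1 p.2.1 in (t.1, t.2 * p.2.2.2))) => /=.
  by repeat group_step.
have cu : computable (fun p : T * (state D * label D) =>
    unfold_state io p.2.2.1 p.2.1).
  by apply: computable_unfold_state; repeat group_step.
by repeat group_step.
Qed.

Lemma computable_path_inv (T : countType) (p : T -> seq (label D)) :
  computable p -> computable (fun x => path_inv (p x)).
Proof. by move=> cp; rewrite /path_inv /label_inv; repeat group_step. Qed.

Lemma computable_path_subst (T : countType) (B : T -> seq (seq (label D)))
    (w : T -> word nat) :
  computable B -> computable w -> computable (fun x => path_subst (B x) (w x)).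
Proof.
move=> cB cw; apply: computable_flatten; apply: computable_map => //.
by apply: computable_if; [|apply: computable_path_inv|]; repeat group_step.
Qed.

Lemma computable_trivial_path (T : countType) (p : T -> seq (label D)) :
  computable p -> computable (fun x => trivial_path C io (p x)).
Proof.
move=> cp; apply: computable_eq; last exact: computable_const.
exact: computable_run.
Qed.

Section Closing.

Variables (T : countType) (E : T -> seq (edge D)) (R : T -> seq (word nat)).
Hypotheses (cE : computable E) (cR : computable R).

Lemma computable_closing (v : T -> nat) (e : T -> label D) (u : T -> nat)
    (z : T -> word nat) :
  computable v -> computable e -> computable u -> computable z ->
  computable (fun x => closing (E x) (R x) (v x) (e x) (u x) (z x)).
Proof. by move=> cv ce cu cz; rewrite /closing; repeat group_step. Qed.

End Closing.

Section Subchecks.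

Variables (T : countType) (E : T -> seq (edge D)) (R : T -> seq (word nat)).
Hypotheses (cE : computable E) (cR : computable R).

Ltac check_step := first [ group_step
  | match goal with
    | |- computable (fun x => closing (@?E x) (@?R x) (@?v x) (@?e x) (@?u x) (@?z x)) =>
        apply: (@computable_closing _ E R _ _ v e u z)
    end; cbv beta ].

Lemma computable_check_mul : computable (fun x => check_mul (E x) (R x)).
Proof. by rewrite /check_mul; repeat check_step. Qed.

Lemma computable_check_inv : computable (fun x => check_inv (E x) (R x)).
Proof. by rewrite /check_inv /label_inv; repeat check_step. Qed.

Lemma computable_check_unit : computable (fun x => check_unit (E x) (R x)).
Proof. by rewrite /check_unit; repeat check_step. Qed.

Lemma computable_check_edge : computable (fun x => check_edge C io (E x) (R x)).
Proof. by rewrite /check_edge; repeat check_step. Qed.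

Lemma computable_check_fixed : computable (fun x => check_fixed io (E x)).
Proof. by rewrite /check_fixed; repeat check_step. Qed.

Lemma computable_reads (v : T -> nat) (p : T -> seq (edge D)) (u : T -> nat) :
  computable v -> computable p -> computable u ->
  computable (fun x => reads (E x) (v x) (p x) (u x)).
Proof.
move=> cv cp cu; apply: computable_eq; last by repeat check_step.
apply: (@computable_foldl _ _ _ (fun x (s : nat * bool) (e : edge D) =>
  (e.2.2.1, [&& s.2, e.1 == s.1 & e \in E x]))); repeat check_step.
Qed.

Lemma computable_check_sub (A B : T -> seq (seq (label D))) :
  computable A -> computable B ->
  computable (fun x => check_sub C io (A x) (B x) (R x)).
Proof.
move=> cA cB; rewrite /check_sub; do 2!check_step => //; first by repeat check_step.
apply: computable_trivial_path; apply: computable_cat; first by repeat check_step.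
by apply: computable_path_inv; apply: computable_path_subst; repeat check_step.
Qed.

Lemma computable_check_rels (gens : T -> seq (seq (label D))) :
  computable gens -> computable (fun x => check_rels C io (gens x) (R x)).
Proof.
move=> cg; rewrite /check_rels; apply: computable_all => //.
apply: computable_andb; first by repeat check_step.
by apply: computable_trivial_path; apply: computable_path_subst; repeat check_step.
Qed.

End Subchecks.

Lemma computable_check_lassos (T : countType) (E : T -> seq (edge D))
    (R : T -> seq (word nat)) (Q : T -> seq (lasso D)) :
  computable E -> computable R -> computable Q ->
  computable (fun x => check_lassos (E x) (R x) (Q x)).
Proof.
move=> cE cR cQ; rewrite /check_lassos /edge_words /edge_word.
have cr (v : T * lasso D -> nat) p u : computable v -> computable p -> computable u ->
    computable (fun x => reads (E x.1) (v x) (p x) (u x)).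
  by apply: computable_reads; repeat group_step.
by repeat first [group_step | apply: cr].
Qed.

Lemma computable_cert_gens (T : countType) (c : T -> certificate D) :
  computable c -> computable (fun x => cert_gens (c x)).
Proof. by move=> cc; rewrite /cert_gens /lasso_labels; repeat group_step. Qed.

Lemma computable_check (T : countType) (hs : T -> seq (seq (label D)))
    (c : T -> certificate D) :
  computable hs -> computable c -> computable (fun x => check C io (hs x) (c x)).
Proof.
move=> ch cc; have cg := computable_cert_gens cc.
have cE : computable (fun x => (c x).1) by repeat group_step.
have cQ : computable (fun x => (c x).2.1) by repeat group_step.
have cR : computable (fun x => (c x).2.2.1) by repeat group_step.
have c1 : computable (fun x => (c x).2.2.2.1) by repeat group_step.
have c2 : computable (fun x => (c x).2.2.2.2) by repeat group_step.
rewrite /check.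
apply: computable_andb; first exact: computable_check_mul.
apply: computable_andb; first exact: computable_check_inv.
apply: computable_andb; first exact: computable_check_unit.
apply: computable_andb; first exact: computable_check_edge.
apply: computable_andb; first exact: computable_check_fixed.
apply: computable_andb; first exact: (computable_check_lassos cE cR cQ).
apply: computable_andb; first exact: (computable_check_rels cR cg).
apply: computable_andb; first exact: (computable_check_sub c1 ch cg).
exact: (computable_check_sub c2 cg ch).
Qed.

End ComputableCheck.

(** * Presentations read off from certificates *)

Section Presentation.

Variables (X : Type) (D : finGroupType) (to_word : seq (label D) -> word X).

Definition cert_presentation (c : certificate D) : sub_presentation X :=
  let gens := [seq to_word g | g <- cert_gens c] in
  existT _ (size gens)
    (in_tuple gens, [seq restrict_word (size gens) r | r <- cert_rels c]).

(** The type of a presentation depends on its number of generators, whereas the rules for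
    [computable] build functions between fixed types. This form has the same code, as ordinals,
    tuples and tagged pairs are coded by their underlying data. *)
Definition cert_output (c : certificate D) : nat * (seq (word X) * seq (word nat)) :=
  let gens := [seq to_word g | g <- cert_gens c] in
  (size gens, (gens, cert_rels c)).

End Presentation.

Lemma pickle_cert_presentation (X : countType) (D : finGroupType)
    (to_word : seq (label D) -> word X) (c : certificate D) :
  (forall r, r \in cert_rels c -> all (fun l => l.1 < size (cert_gens c)) r) ->
  pickle (cert_presentation to_word c) = pickle (cert_output to_word c).
Proof.
move=> bound; set gens := [seq to_word g | g <- cert_gens c].
have -> : cert_output to_word c = (size gens, (gens,
    [seq word_map val (restrict_word (size gens) r) | r <- cert_rels c])).
  congr (_, (_, _)); rewrite -[LHS]map_id; apply/eq_in_map => r /bound br.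
  by rewrite restrict_word_id // /gens size_map.
rewrite /cert_presentation -/gens.
have pickle_word (w : word 'I_(size gens)) : pickle w = pickle (word_map val w).
  have -> : pickle (word_map val w) = CodeSeq.code [seq pickle l | l <- word_map val w] by [].
  by rewrite -map_comp; congr CodeSeq.code; apply: eq_map => -[].
have pickle_words (s : seq (word 'I_(size gens))) :
    pickle s = pickle [seq word_map val w | w <- s].
  have -> : pickle [seq word_map val w | w <- s] =
    CodeSeq.code [seq pickle w | w <- [seq word_map val w | w <- s]] by [].
  rewrite -map_comp; congr CodeSeq.code; apply: eq_map; exact: pickle_word.
rewrite (_ : [seq word_map val (restrict_word _ r) | r <- cert_rels c] =
  [seq word_map val w | w <- [seq restrict_word (size gens) r | r <- cert_rels c]]);
  last by rewrite -map_comp.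
rewrite [RHS]pickle_pair pickle_pair -pickle_words.
by [].
Qed.

Theorem corollary5p4
    (X1 X2 Y : finType) (R1 : seq (word X1)) (R2 : seq (word X2))
    (G1 G2 : finGroupType) (gen1 : X1 -> G1) (gen2 : X2 -> G2)
    (A : groupType) (genA : Y -> A)
    (phi1 : {multiplicative A -> G1}) (phi2 : {multiplicative A -> G2})
    (u1 : Y -> word X1) (u2 : Y -> word X2)
    (G : groupType) (gen : (X1 + X2)%type -> G)
    (presG1 : presents (@whole G1) gen1 R1)
    (presG2 : presents (@whole G2) gen2 R2)
    (genAY : forall a : A, subgroup_gen (image_of genA) a)
    (phi1_inj : injective phi1) (phi2_inj : injective phi2)
    (u1E : forall y, word_val gen1 (u1 y) = phi1 (genA y))
    (u2E : forall y, word_val gen2 (u2 y) = phi2 (genA y))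
    (presG : presents (@whole G) gen (amalgam_rels R1 R2 u1 u2)) :
  exists2 alg : seq (word (X1 + X2)%type) -> sub_presentation (X1 + X2)%type,
    computable alg &
    forall hs : seq (word (X1 + X2)%type),
      sub_presents gen
        (subgroup_gen (fun g => g \in [seq word_val gen h | h <- hs]))
        (alg hs).
Proof.
pose D : finGroupType := (G1 * G2)%type.
pose C := amalgamated_group phi1 phi2.
pose io := @factor G1 G2.
(* The spelling of each label is chosen classically, but there are finitely many labels, so this is
   a finite table applied label by label. *)
pose to_word := label_words presG1 presG2.
pose F := val_factor gen presG1 presG2.
have ioM b : {morph io b : x y / (x * y)%g} by apply: factorM.
have ioK b x : io b (io b x) = io b x by case: b.
have FM b : {morph F b : x y / (x * y)%g} by apply: (val_factorM presG1 presG2 presG).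
have F_edge c : c \in C -> F false (io false c) = F true (io true c).
  exact: (val_factor_edge presG1 presG2 genAY u1E u2E presG).
have trivP p : all (fun e : label D => io e.1 e.2 == e.2) p ->
    path_val F p = 1%g <-> trivial_path C io p.
  move=> fp; have pE := path_val_eq1 presG1 presG2 genAY phi1_inj phi2_inj u1E u2E presG fp.
  by split=> [/pE/eqP|/eqP/pE].
pose input (hs : seq (word (X1 + X2)%type)) : seq (seq (label D)) :=
  [seq [seq letter_label gen1 gen2 l | l <- h] | h <- hs].
have fixed_input hs : all (all (fun e : label D => io e.1 e.2 == e.2)) (input hs).
  by apply/allP => _ /mapP[h _ ->]; apply/allP => _ /mapP[l _ ->];
    apply: letter_label_in_factor.
have [f cf fP] : exists2 f : seq (word (X1 + X2)%type) -> certificate D,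
    computable f & forall hs, check C io (input hs) (f hs).
  apply: (computable_search (check := fun hs c => check C io (input hs) c)).
  - by do 2!apply: decidable_codes_seq; apply: decidable_codes_fin.
  - have dw : decidable_codes (word nat).
      apply/decidable_codes_seq/decidable_codes_pair.
        exact: decidable_codes_nat.
      exact: decidable_codes_fin.
    have de : decidable_codes (edge D).
      do ![apply: decidable_codes_pair => //|exact: decidable_codes_nat
          |exact: decidable_codes_fin].
    have dE : decidable_codes (seq (edge D)) by apply: decidable_codes_seq.
    have dW : decidable_codes (seq (word nat)) by apply: decidable_codes_seq.
    have dL : decidable_codes (seq (lasso D)).
      by apply: decidable_codes_seq; do 2!apply: decidable_codes_pair => //.
    by do 4!apply: decidable_codes_pair => //.
  - apply: computable_check; last exact/computable_snd/computable_id.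
    apply: computable_map; first exact/computable_fst/computable_id.
    apply: computable_map; first exact/computable_snd/computable_id.
    exact/computable_fin/computable_snd/computable_id.
  - by move=> hs; apply: (exists_certificate ioM ioK FM F_edge trivP).
have boundP hs r : r \in cert_rels (f hs) ->
    all (fun l => l.1 < size (cert_gens (f hs))) r.
  by move=> rR; rewrite size_map; apply: (cert_rels_bounded (fP hs)).
exists (fun hs => cert_presentation to_word (f hs)).
  have [O RO OE] : computable (fun hs => cert_output to_word (f hs)).
    have cg := computable_cert_gens cf.
    have cg' : computable (fun hs => [seq to_word g | g <- cert_gens (f hs)]).
      apply: (@computable_map _ _ _ (fun _ => to_word)) => //.
      apply: computable_flatten; apply: computable_map.
        exact/computable_snd/computable_id.
      exact/computable_fin/computable_snd/computable_id.
    apply: computable_pair; first exact: computable_size.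
    apply: computable_pair => //.
    exact/computable_fst/computable_snd/computable_snd.
  by exists O => // hs; rewrite OE pickle_cert_presentation //; apply: boundP.
move=> hs; rewrite /sub_presents /cert_presentation.
set gens := [seq to_word g | g <- cert_gens (f hs)].
have genE (i : 'I_(size gens)) :
    word_val gen (tnth (in_tuple gens) i) = cert_val F (f hs) i.
  have ig : i < size (cert_gens (f hs)) by rewrite -(size_map to_word).
  rewrite (tnth_nth [::]) /= (nth_map [::]) //.
  exact: label_words_val.
split=> [g|w].
  have <- : [seq path_val F p | p <- input hs] = [seq word_val gen h | h <- hs].
    by rewrite -map_comp; apply: eq_map => h; apply: (letter_path_val presG1 presG2 presG).
  apply: iff_trans (cert_generates ioM FM trivP (fixed_input hs) (fP hs) g) _.
  split; apply: subgroup_gen_sub => s.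
    case/mapP=> p /(nthP [::])[i ip <-] ->; apply: subgroup_gen_in.
    have ig : i < size gens by rewrite size_map.
    by exists (Ordinal ig); rewrite genE.
  case=> i ->; rewrite genE; apply: subgroup_gen_in; apply: map_f; apply: mem_nth.
  by rewrite -(size_map to_word).
have -> : word_val (fun i => word_val gen (tnth (in_tuple gens) i)) w =
    word_val (cert_val F (f hs)) (word_map val w).
  rewrite word_val_map; apply: eq_bigr => l _; by rewrite genE.
have wb : all (fun l => l.1 < size (cert_lassos (f hs))) (word_map val w).
  rewrite -(size_map (@lasso_labels D)) -(size_map to_word) all_map.
  by apply/allP => l _ /=.
(* [cert_kernel] speaks of derivations over all of [nat]: they are retracted to the letters below
   [size gens], and in the other direction the bounded relators embed unchanged. *)
have K := cert_kernel ioM FM trivP (fP hs) wb; split=> [/K|wR].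
  by move/(pres_eq_restrict (size gens)); rewrite restrict_wordK.
apply/K; apply: (pres_eq_map (f := val) _ wR) => _ /mapP[r rR ->].
rewrite restrict_word_id; first exact: pres_eq_rel.
by rewrite size_map; apply: boundP.
Qed.
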